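(* If $q$ is odd and fixed, then $$\lim_{n\to\infty}\frac{i(\mathrm{SO}(2n+1,q))}{q^{n^2+n}}=\prod_{i\ge 1}(1+1/q^{2i})^2.$$
   Context: $q$ is an odd prime power. $\mathrm{O}(2n+1,q)$ is the isometry group of the quadratic form $x_1x_2+x_3x_4+\cdots+x_{2n-1}x_{2n}+x_{2n+1}^2$ on $\mathbb{F}_q^{2n+1}$ (any other non-degenerate quadratic form on $\mathbb{F}_q^{2n+1}$ gives an isomorphic group), and $\mathrm{SO}(2n+1,q)$ is its subgroup of determinant $1$ elements. $i(X)$ denotes the number of $g\in X$ with $g^2=1$ (the identity is counted). *)

(* Defs.v *)
From HB Require Import structures.
From mathcomp Require Import all_boot all_order all_algebra all_fingroup.

Set Implicit Arguments.
Unset Strict Implicit.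
Unset Printing Implicit Defensive.

Import GRing.Theory.
Local Open Scope ring_scope.

(* x_1 x_2 + x_3 x_4 + ... + x_(2n-1) x_(2n) + x_(2n+1)^2, with the
   coordinates numbered from 0; every index below is < 2n+1, so [inord] never
   falls back on its default value. *)
Definition oddQ (F : finFieldType) (n : nat) (x : 'rV[F]_(n.*2.+1)) : F :=
  \sum_(i < n) x 0 (inord i.*2) * x 0 (inord i.*2.+1) + x 0 ord_max ^+ 2.

(* Invertible matrices act on row vectors by right multiplication. *)
Definition Oodd_set (F : finFieldType) (n : nat) : {set {'GL_(n.*2.+1)[F]}} :=
  [set g : {'GL_(n.*2.+1)[F]} |
    [forall x : 'rV[F]_(n.*2.+1), oddQ (x *m GLval g) == oddQ x]].

Lemma Oodd_group_set (F : finFieldType) (n : nat) : group_set (Oodd_set F n).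
Proof.
apply/group_setP; split=> [|g h].
  by rewrite inE; apply/forallP => x; rewrite GL_1E mulmx1.
rewrite !inE => /forallP gQ /forallP hQ; apply/forallP => x.
by rewrite GL_ME mulmxA (eqP (hQ _)) (eqP (gQ _)).
Qed.

Canonical Oodd (F : finFieldType) (n : nat) : {group {'GL_(n.*2.+1)[F]}} :=
  Group (Oodd_group_set F n).

Definition SOodd_set (F : finFieldType) (n : nat) : {set {'GL_(n.*2.+1)[F]}} :=
  [set g in Oodd F n | \det (GLval g) == 1].

Lemma SOodd_group_set (F : finFieldType) (n : nat) : group_set (SOodd_set F n).
Proof.
apply/group_setP; split=> [|g h].
  by rewrite inE group1 GL_1E det1 eqxx.
rewrite !(inE, in_set) => /andP[gO /eqP dg] /andP[hO /eqP dh].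
have -> : \det (GLval (g * h)%g) = 1 by rewrite GL_ME det_mulmx dg dh mulr1.
rewrite eqxx andbT.
by have := groupM (G := Oodd F n) (x := g) (y := h); rewrite !inE; apply.
Qed.

Canonical SOodd (F : finFieldType) (n : nat) : {group {'GL_(n.*2.+1)[F]}} :=
  Group (SOodd_group_set F n).

(* The identity is counted. *)
Definition ninvol (gT : finGroupType) (A : {set gT}) : nat :=
  #|[set g in A | (g ^+ 2 == 1)%g]|.

(* Main.v *)
(* An involution g of SO(2n+1,q) is 1 - 2P, where P is the orthogonal projection
   onto the (nondegenerate) -1 eigenspace, whose dimension is even.  So one has
   to count the nondegenerate subspaces of dimension 2k.  In every nondegenerate
   space of dimension d, the number of nondegenerate planes depends on d only:
   the type of the form cancels.  Double counting the flags (plane inside a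
   2k-dimensional subspace) therefore gives a recursion, and with Q = q^2,
   w = 1/Q, the number of these subspaces is Q^(2k(n-k)+k) [n,k]_w.  Divided by
   q^(n^2+n) = Q^(n(n+1)/2), this is [n,k]_w w^(t(t+1)/2), where each t in [0, n]
   occurs for exactly one k, and dominated convergence gives the limit
   sum_t w^(t(t+1)/2) / prod_i (1 - w^i).  A finite form of Gauss' identity writes
   prod_(i <= m) (1 + w^i)^2 as sum_(t <= m) [2m+1,m+1+t]_w w^(t(t+1)/2), so these
   products have the same limit. *)
Require Import Defs.
From mathcomp Require Import all_boot all_order all_algebra all_fingroup.
From mathcomp Require Import cyclic zify ring lra.
From mathcomp Require Import all_classical all_reals all_analysis.

Set Implicit Arguments.
Unset Strict Implicit.
Unset Printing Implicit Defensive.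

Import Order.TTheory GRing.Theory Num.Theory.
Import numFieldNormedType.Exports.
Local Open Scope ring_scope.

(** * Self-adjoint idempotents *)

Definition nondeg_form (F : fieldType) (d : nat) (G : 'M[F]_d) : bool :=
  (G^T == G) && (G \in unitmx).

(* Vectors are rows, so P is self-adjoint for the form x G y^T when
   P G = G P^T.  These P correspond to the nondegenerate subspaces of dimension k,
   by taking the row space. *)
Definition sadj_idem (F : finFieldType) (d : nat) (G : 'M[F]_d) (k : nat) :
    {set 'M[F]_d} :=
  [set P : 'M[F]_d | [&& P *m P == P, P *m G == G *m P^T & \rank P == k]].

Lemma sadj_idemP (F : finFieldType) (d : nat) (G : 'M[F]_d) (k : nat) (P : 'M[F]_d) :
  reflect [/\ P *m P = P, P *m G = G *m P^T & \rank P = k]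
          (P \in sadj_idem G k).
Proof.
rewrite inE; apply: (iffP and3P) => [[/eqP-> /eqP-> /eqP->]|[-> -> ->]] //.
Qed.

(** Rank factorization into a column base [C] and a row base [R]. As [C] is left invertible and [R]
    right invertible, [C R C R = C R] cancels to [R C = 1]. *)
Lemma idem_factor (F : fieldType) (d r : nat) (P : 'M[F]_d) :
  P *m P = P -> \rank P = r ->
  exists C : 'M[F]_(d, r), exists2 R : 'M[F]_(r, d), P = C *m R & R *m C = 1%:M.
Proof.
move=> PP rP; case: r / rP; exists (col_base P), (row_base P).
  by rewrite mulmx_base.
have/row_freeP := row_base_free P; have/row_fullP := col_base_full P.
move: (col_base P) (row_base P) (mulmx_base P) => C R.
move: (\rank P) C R => r C R PE [A AC] [B RB].
have := congr1 (fun M => A *m M *m B) PP.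
by rewrite /= -PE !mulmxA AC !mul1mx -!mulmxA RB !mulmx1.
Qed.

(** The rows of [R] form a basis of the row space of [P], with Gram matrix [R G R^T].
    Self-adjointness gives [P G R^T = G R^T], which is the last equation, and makes [C^T G^-1 C] an
    inverse of the Gram matrix. *)
Lemma sadj_idem_factor (F : finFieldType) (d r : nat) (G P : 'M[F]_d) :
    nondeg_form G -> P \in sadj_idem G r ->
  exists C : 'M[F]_(d, r), exists R : 'M[F]_(r, d),
    [/\ P = C *m R, R *m C = 1%:M, nondeg_form (R *m G *m R^T)
      & G *m R^T = C *m (R *m G *m R^T)].
Proof.
move=> /andP[/eqP Gs Gu] /sadj_idemP[PP PG rP].
have [C [R PE RC]] := idem_factor PP rP; exists C, R.
have GR : G *m R^T = C *m (R *m G *m R^T).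
  have : P *m G *m R^T = G *m R^T.
    by rewrite PG -mulmxA -trmx_mul PE mulmxA RC mul1mx.
  by rewrite PE -!mulmxA.
split=> //; apply/andP; split.
  by rewrite !trmx_mul trmxK Gs mulmxA.
have/mulmx1_unit[] // : (R *m G *m R^T) *m (C^T *m invmx G *m C) = 1%:M.
rewrite !mulmxA.
have -> : R *m G *m R^T *m C^T = R *m G.
  by rewrite -!mulmxA -trmx_mul -PE -PG PE !mulmxA RC mul1mx.
by rewrite mulmxK.
Qed.

(** [P' P = P'] says that the row space of [P'] lies in that of [P]. In the coordinates given by
    [R], such [P'] are the matrices [C p R] with [p] a self-adjoint idempotent for the restricted
    form [S]. *)
Lemma card_sadj_idem_corner (F : finFieldType) (d r j : nat) (G P : 'M[F]_d) :
    nondeg_form G -> P \in sadj_idem G r ->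
  exists2 S : 'M[F]_r, nondeg_form S &
    #|[set P' in sadj_idem G j | P' *m P == P']| = #|sadj_idem S j|.
Proof.
move=> Gn PE; have [C [R [Pf RC Sn GR]]] := sadj_idem_factor Gn PE.
move: (R *m G *m R^T) Sn GR => S Sn GR; exists S => //.
have [/eqP Gs Gu] := andP Gn.
have RG : R *m G = S *m C^T.
  have /andP[/eqP Ss _] := Sn.
  by have := congr1 trmx GR; rewrite trmx_mul trmxK Gs trmx_mul Ss.
pose f (p : 'M[F]_r) := C *m p *m R.
have fK p : R *m f p *m C = p.
  by rewrite /f !mulmxA RC mul1mx -mulmxA RC mulmx1.
have finj : injective f by move=> p q epq; rewrite -(fK p) epq fK.
rewrite -(card_imset _ finj); congr #|pred_of_set _|; apply/finset.setP=> P'.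
have fsadj p : (f p \in sadj_idem G j) = (p \in sadj_idem S j).
  have rf : \rank (f p) = \rank p.
    apply/eqP; rewrite eqn_leq (leq_trans (mxrankM_maxl _ _)) ?mxrankM_maxr //=.
    by rewrite -{1}(fK p) (leq_trans (mxrankM_maxl _ _)) ?mxrankM_maxr.
  have ff : f p *m f p = f (p *m p).
    by rewrite /f !mulmxA -(mulmxA (C *m p)) RC mulmx1.
  rewrite !inE rf ff (inj_eq finj).
  suff -> : (f p *m G == G *m (f p)^T) = (p *m S == S *m p^T) by [].
  have -> : f p *m G = C *m (p *m S) *m C^T by rewrite /f -!mulmxA RG.
  have -> : G *m (f p)^T = C *m (S *m p^T) *m C^T.
    by rewrite /f !trmx_mul !mulmxA GR -!mulmxA.
  apply/eqP/eqP => [|-> //] /(congr1 (fun M => R *m M *m R^T)).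
  by rewrite !mulmxA RC !mul1mx -!(mulmxA _ C^T) -trmx_mul RC trmx1 !mulmx1.
rewrite inE; apply/andP/imsetP => [[P'E /eqP P'P]|[p pE ->]]; last first.
  by rewrite fsadj; split=> //; rewrite Pf /f mulmxA -(mulmxA _ R C) RC mulmx1.
(* This is the adjoint of [P' P = P']. *)
have PP' : P *m P' = P'.
  have [[_ PG _] [_ P'G _]] := (sadj_idemP _ _ _ PE, sadj_idemP _ _ _ P'E).
  apply: (can_inj (mulmxK Gu)); rewrite -mulmxA P'G mulmxA PG -mulmxA.
  by rewrite -trmx_mul P'P.
have P'f : P' = f (R *m P' *m C).
  by rewrite /f !mulmxA -Pf PP' -mulmxA -Pf P'P.
by exists (R *m P' *m C); rewrite -?fsadj -?P'f.
Qed.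

(** The two row spaces meet trivially, and that of the sum contains both because [A (A + B) = A] and
    [B (A + B) = B]. *)
Lemma mxrankD_idem (F : fieldType) (d : nat) (A B : 'M[F]_d) :
    A *m A = A -> B *m B = B -> A *m B = 0 -> B *m A = 0 ->
  \rank (A + B)%R = (\rank A + \rank B)%N.
Proof.
move=> AA BB AB BA.
have cap0 : (A :&: B = 0)%MS.
  apply/eqP/rowV0P => v; rewrite sub_capmx => /andP[/submxP[x ->] /submxP[y xy]].
  by rewrite -AA mulmxA xy -mulmxA BA mulmx0.
rewrite -(mxrank_disjoint_sum cap0); apply/eqmx_rank; apply/andP; split; first by rewrite addmx_sub_adds.
rewrite addsmx_sub; apply/andP; split; apply/submxP.
  by exists A; rewrite mulmxDr AA AB addr0.
by exists B; rewrite mulmxDr BB BA add0r.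
Qed.

Lemma sadj_idem_compl (F : finFieldType) (d k : nat) (G P : 'M[F]_d) :
  P \in sadj_idem G k -> 1%:M - P \in sadj_idem G (d - k)%N.
Proof.
case/sadj_idemP=> PP PG rP.
have P1 : P *m (1%:M - P) = 0 by rewrite mulmxBr mulmx1 PP subrr.
have P2 : (1%:M - P) *m P = 0 by rewrite mulmxBl mul1mx PP subrr.
have P3 : (1%:M - P) *m (1%:M - P) = 1%:M - P by rewrite mulmxBl P1 mul1mx subr0.
apply/sadj_idemP; split=> //.
  by rewrite mulmxBl mul1mx PG linearB /= trmx1 mulmxBr mulmx1.
have := mxrankD_idem PP P3 P1 P2; rewrite addrC subrK mxrank1 rP => dE.
by rewrite [X in (X - k)%N]dE addKn.
Qed.

(** Subtracting [P'] maps the subspaces above it bijectively to those inside its orthogonal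
    complement, and the corner count applies to the projection [1 - P'] onto that complement. *)
Lemma card_sadj_idem_above (F : finFieldType) (d j k : nat) (G P' : 'M[F]_d) :
    nondeg_form G -> (j <= k)%N -> P' \in sadj_idem G j ->
  exists2 S : 'M[F]_(d - j), nondeg_form S &
    #|[set P in sadj_idem G k | P' *m P == P']| = #|sadj_idem S (k - j)|.
Proof.
move=> Gn jk P'E; have P'cE := sadj_idem_compl P'E.
have [S Sn cS] := card_sadj_idem_corner (k - j) Gn P'cE.
exists S => //; rewrite -{}cS.
have [/eqP Gs Gu] := andP Gn.
have [P'P' P'G rP'] := sadj_idemP _ _ _ P'E.
rewrite -[RHS](card_imset _ (@addIr _ P')).
apply: eq_card => P; apply/idP/imsetP.
  rewrite inE => /andP[/sadj_idemP[PP PG rP] /eqP P'P].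
  have PP' : P *m P' = P'.
    apply: (can_inj (mulmxK Gu)).
    by rewrite -mulmxA P'G mulmxA PG -mulmxA -trmx_mul P'P.
  exists (P - P'); last by rewrite subrK.
  have P1 : (P - P') *m P' = 0 by rewrite mulmxBl PP' P'P' subrr.
  have P2 : P' *m (P - P') = 0 by rewrite mulmxBr P'P P'P' subrr.
  have P3 : (P - P') *m (P - P') = P - P' by rewrite mulmxBl P2 subr0 mulmxBr PP PP'.
  rewrite inE mulmxBr mulmx1 P1 subr0 eqxx andbT; apply/sadj_idemP; split=> //.
    by rewrite mulmxBl PG P'G linearB /= mulmxBr.
  by have := mxrankD_idem P3 P'P' P1 P2; rewrite subrK rP rP' => ->; rewrite addnK.
case=> A /setIdP[/sadj_idemP[AA AG rA] /eqP AP' ->].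
have {}AP' : A *m P' = 0.
  by rewrite -AP' -mulmxA mulmxBl mul1mx P'P' subrr mulmx0.
have P'A : P' *m A = 0.
  apply: (can_inj (mulmxK Gu)); rewrite -mulmxA AG mulmxA P'G -mulmxA.
  by rewrite -trmx_mul AP' trmx0 mulmx0 mul0mx.
rewrite inE mulmxDr P'A P'P' add0r eqxx andbT; apply/sadj_idemP; split.
- by rewrite mulmxDl !mulmxDr AA AP' P'A P'P' addr0 add0r.
- by rewrite mulmxDl AG P'G linearD /= mulmxDr.
- by rewrite mxrankD_idem // rA rP' subnK.
Qed.

(** Double counting of the flags [P'] inside [P]. The values [a] and [b] live in a semiring, so that
    formulas with quotients can be plugged in. *)
Lemma sadj_idem_flags (R : nzSemiRingType) (a b : R) (F : finFieldType)
    (d j k : nat) (G : 'M[F]_d) :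
    nondeg_form G -> (j <= k)%N ->
    (forall S : 'M[F]_k, nondeg_form S -> #|sadj_idem S j|%:R = a) ->
    (forall S : 'M[F]_(d - j), nondeg_form S -> #|sadj_idem S (k - j)|%:R = b) ->
  #|sadj_idem G k|%:R * a = #|sadj_idem G j|%:R * b.
Proof.
move=> Gn jk ha hb; rewrite !mulr_natl -!sumr_const.
transitivity (\sum_(P in sadj_idem G k)
    \sum_(P' in sadj_idem G j | P' *m P == P') (1 : R)).
  apply: eq_bigr => P PE; have [S Sn cS] := card_sadj_idem_corner j Gn PE.
  by rewrite -(ha S Sn) -cS -sumr_const; apply: eq_bigl => P'; rewrite inE.
rewrite (exchange_big_dep (mem (sadj_idem G j))) /=; last by move=> ? ? _ /andP[].
apply: eq_bigr => P' P'E; have [S Sn cS] := card_sadj_idem_above Gn jk P'E.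
rewrite -(hb S Sn) -cS -sumr_const; apply: eq_bigl => P.
by rewrite inE P'E.
Qed.

Definition units_mx (F : finFieldType) (k : nat) : {set 'M[F]_k} :=
  [set h | h \in unitmx].

(** This is the Gram formula for the orthogonal projection onto the row space of [X]. *)
Lemma sadj_idem_proj (F : finFieldType) (d k : nat) (G : 'M[F]_d) (X : 'M[F]_(k, d)) :
    nondeg_form G -> X *m G *m X^T \in unitmx ->
  G *m X^T *m invmx (X *m G *m X^T) *m X \in sadj_idem G k /\
  X *m (G *m X^T *m invmx (X *m G *m X^T) *m X) = X.
Proof.
move=> /andP[/eqP Gs Gu] Xu; set S := X *m G *m X^T in Xu *.
have Ss : S^T = S by rewrite /S !trmx_mul trmxK Gs mulmxA.
set P := _ *m X.
have XP : X *m P = X by rewrite /P !mulmxA -/S mulmxV // mul1mx.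
split=> //; apply/sadj_idemP; split.
- by rewrite {1}/P -mulmxA XP.
- by rewrite /P !trmx_mul trmxK Gs trmx_inv Ss !mulmxA.
- apply/eqP; rewrite eqn_leq; apply/andP; split.
    exact: leq_trans (mxrankM_maxr _ _) (rank_leq_row _).
  have SE : S = X *m (P *m (G *m X^T)) by rewrite mulmxA XP mulmxA.
  rewrite -[leqLHS](mxrank_unit Xu) SE.
  exact: leq_trans (mxrankM_maxr _ _) (mxrankM_maxl _ _).
Qed.

(** Each [X] is a basis of one nondegenerate subspace. Over the projection [P = C R] the fibre
    consists of the [h R] with [h] invertible. *)
Lemma card_nondeg_frames (F : finFieldType) (d k : nat) (G : 'M[F]_d) :
    nondeg_form G ->
  #|[set X : 'M[F]_(k, d) | X *m G *m X^T \in unitmx]| =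
  (#|sadj_idem G k| * #|units_mx F k|)%N.
Proof.
move=> Gn; pose proj (X : 'M[F]_(k, d)) := G *m X^T *m invmx (X *m G *m X^T) *m X.
rewrite -sum1_card (partition_big proj (mem (sadj_idem G k))) /=; last first.
  by move=> X; rewrite inE => Xu; have [] := sadj_idem_proj Gn Xu.
rewrite -sum_nat_const; apply: eq_bigr => P PE.
have [C [R [Pf RC Sn GR]]] := sadj_idem_factor Gn PE; have [_ Su] := andP Sn.
rewrite sum1dep_card -(card_imset (mem (units_mx F k)) (f := mulmx^~ R)); last first.
  by move=> x y /(congr1 (mulmx^~ C)); rewrite -!mulmxA RC !mulmx1.
apply: eq_card => X; rewrite !inE; apply/andP/imsetP => [[Xu /eqP XP]|[h]].
  have [_ XPX] := sadj_idem_proj Gn Xu; rewrite -/(proj X) XP Pf mulmxA in XPX.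
  exists (X *m C) => //; rewrite inE.
  have XE : X *m G *m X^T = (X *m C) *m (R *m G *m X^T) by rewrite !mulmxA XPX.
  by move: Xu; rewrite XE unitmx_mul => /andP[].
rewrite inE => hu ->.
have ES : h *m R *m G *m (h *m R)^T = h *m (R *m G *m R^T) *m h^T.
  by rewrite trmx_mul !mulmxA.
split; first by rewrite ES !unitmx_mul hu Su unitmx_tr.
apply/eqP; rewrite /proj ES; move: (R *m G *m R^T) Su GR => S Su GR.
have Tu : h *m S *m h^T \in unitmx by rewrite !unitmx_mul hu Su unitmx_tr.
have hTu : h^T \in unitmx by rewrite unitmx_tr.
have MS : h^T *m invmx (h *m S *m h^T) *m h *m S = 1%:M.
  apply: (can_inj (mulmxK hTu)).
  by rewrite mul1mx -!mulmxA (mulmxA h) mulVmx // mulmx1.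
rewrite trmx_mul (mulmxA G) GR Pf !mulmxA; congr (_ *m R).
rewrite -!mulmxA; have := mulmx1C MS; rewrite -!mulmxA => ->.
by rewrite mulmx1.
Qed.

(** * Isotropic vectors *)

Definition bform (F : fieldType) (d : nat) (G : 'M[F]_d) (x y : 'rV[F]_d) : F :=
  (x *m G *m y^T) 0 0.

Lemma bformDl (F : fieldType) (d : nat) (G : 'M[F]_d) (x y z : 'rV[F]_d) :
  bform G (x + y) z = bform G x z + bform G y z.
Proof. by rewrite /bform !mulmxDl mxE. Qed.

Lemma bformDr (F : fieldType) (d : nat) (G : 'M[F]_d) (x y z : 'rV[F]_d) :
  bform G z (x + y) = bform G z x + bform G z y.
Proof. by rewrite /bform linearD mulmxDr mxE. Qed.

Lemma bformZl (F : fieldType) (d : nat) (G : 'M[F]_d) (a : F) (x z : 'rV[F]_d) :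
  bform G (a *: x) z = a * bform G x z.
Proof. by rewrite /bform -!scalemxAl mxE. Qed.

Lemma bformZr (F : fieldType) (d : nat) (G : 'M[F]_d) (a : F) (x z : 'rV[F]_d) :
  bform G z (a *: x) = a * bform G z x.
Proof. by rewrite /bform linearZ /= -scalemxAr mxE. Qed.

Lemma bform0l (F : fieldType) (d : nat) (G : 'M[F]_d) (x : 'rV[F]_d) :
  bform G 0 x = 0.
Proof. by rewrite -(scale0r 0) bformZl mul0r. Qed.

Lemma bformC (F : fieldType) (d : nat) (G : 'M[F]_d) (x y : 'rV[F]_d) :
  nondeg_form G -> bform G x y = bform G y x.
Proof.
case/andP=> /eqP Gs _; rewrite /bform -[x *m G *m y^T]trmxK mxE.
by rewrite !trmx_mul trmxK Gs mulmxA.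
Qed.

Definition bformE := (bformDl, bformDr, bformZl, bformZr).

Lemma bform_pull (F : fieldType) (d k : nat) (G : 'M[F]_d) (R : 'M[F]_(k, d))
    (x y : 'rV[F]_k) :
  bform G (x *m R) (y *m R) = bform (R *m G *m R^T) x y.
Proof. by rewrite /bform trmx_mul !mulmxA. Qed.

Lemma bform_dual (F : fieldType) (d : nat) (G : 'M[F]_d) (x : 'rV[F]_d) :
  nondeg_form G -> x != 0 -> exists w, bform G x w = 1.
Proof.
move=> /andP[_ Gu] x0.
have : x *m G != 0 by apply: contraNneq x0 => xG; rewrite -(mulmxK Gu x) xG mul0mx.
case/rV0Pn=> j xGj; exists (((x *m G) 0 j)^-1 *: delta_mx 0 j).
by rewrite bformZr /bform trmx_delta -colE [X in _ * X]mxE mulVf.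
Qed.

(** [R] comes from factoring the projection onto the orthogonal complement of the rows of [Y], so
    its rows form a basis of that complement. *)
Lemma nondeg_perp (F : finFieldType) (d k : nat) (G : 'M[F]_d) (Y : 'M[F]_(k, d)) :
    nondeg_form G -> Y *m G *m Y^T \in unitmx ->
  exists2 R : 'M[F]_(d - k, d), R *m G *m Y^T = 0 & nondeg_form (R *m G *m R^T).
Proof.
move=> Gn Yu; have [] := sadj_idem_proj Gn Yu; set P := _ *m Y => PE YP.
have [C [R [Pf RC Sn _]]] := sadj_idem_factor Gn (sadj_idem_compl PE).
exists R => //; have /sadj_idemP[_ PG _] := sadj_idem_compl PE.
have RP : R *m (1%:M - P) = R by rewrite Pf mulmxA RC mul1mx.
rewrite -RP -(mulmxA R) PG -!mulmxA -trmx_mul mulmxBr mulmx1 YP subrr.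
by rewrite trmx0 !mulmx0.
Qed.

(** Otherwise 1 has additive order 2, which divides [#|F|]. *)
Lemma finField_2neq0 (F : finFieldType) : odd #|F| -> 2%:R != 0 :> F.
Proof.
move=> qodd; apply/eqP => F2.
have : (#[1%R : F]%g %| 2)%N by rewrite order_dvdn FinRing.zmodXgE F2 FinRing.zmod1gE.
have o1 : (#[1%R : F]%g != 1)%N by rewrite order_eq1 FinRing.zmod1gE oner_eq0.
case/primeP: (isT : prime 2) => _ /[apply]; rewrite (negPf o1) /= => /eqP o2.
by have := order_dvdG (finset.in_setT (1%R : F)); rewrite o2 cardsT dvdn2 qodd.
Qed.

Lemma card_le_double_codom (F : finFieldType) (f : F -> F) :
    (forall x y, f x = f y -> x = y \/ x = - y) ->
  (#|F| <= 2 * #|[set f x | x in F]|)%N.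
Proof.
move=> ff; rewrite -[leqLHS]sum1_card (partition_big f (mem [set f x | x in F])) /=; last first.
  by move=> x _; apply: imset_f.
rewrite mulnC -[leqRHS]sum_nat_const; apply: leq_sum => y /imsetP[x _ ->].
rewrite sum1dep_card; apply: (@leq_trans #|[set x; - x]|); last by rewrite cards2; case: (_ != _).
apply: subset_leq_card; apply/fintype.subsetP=> z; rewrite !inE => /eqP/ff[->|->].
  by rewrite eqxx.
by rewrite eqxx orbT.
Qed.

(** Pigeonhole: squaring is at most two-to-one, so [a s^2] and [c - b t^2] each take at least
    [#|F| / 2] values. As [#|F|] is odd, this is more than half, and the two sets of values meet. *)
Lemma binary_universal (F : finFieldType) (a b c : F) :
    odd #|F| -> a != 0 -> b != 0 ->
  exists s t, a * s ^+ 2 + b * t ^+ 2 = c.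
Proof.
move=> qodd a0 b0.
have sq (x y : F) : x ^+ 2 = y ^+ 2 -> x = y \/ x = - y.
  by move/eqP; rewrite eqf_sqr => /orP[]/eqP; auto.
have hA : (#|F| <= 2 * #|[set (a * s ^+ 2)%R | s in F]|)%N.
  by apply: card_le_double_codom => x y /(mulfI a0)/sq.
have hB : (#|F| <= 2 * #|[set (c - b * s ^+ 2)%R | s in F]|)%N.
  by apply: card_le_double_codom => x y /addrI/oppr_inj/(mulfI b0)/sq.
have [] := boolP [disjoint [set a * s ^+ 2 | s in F] & [set c - b * s ^+ 2 | s in F]].
  rewrite -finset.setI_eq0 => /eqP dAB.
  have := cardsUI [set (a * s ^+ 2)%R | s in F] [set (c - b * s ^+ 2)%R | s in F].
  rewrite dAB cards0 addn0 => cU.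
  have := max_card (mem ([set (a * s ^+ 2)%R | s in F] :|: [set (c - b * s ^+ 2)%R | s in F])).
  rewrite cU; move: hA hB qodd.
  move: #|_| #|[set (a * s ^+ 2)%R | s in F]| #|[set (c - b * s ^+ 2)%R | s in F]|.
  lia.
rewrite -finset.setI_eq0 => /finset.set0Pn[x]; rewrite inE => /andP[/imsetP[s _ ->] /imsetP[t _ e]].
by exists s, t; rewrite e subrK.
Qed.

Lemma exists_left_kernel (F : fieldType) (d k : nat) (A : 'M[F]_(d, k)) :
  (k < d)%N -> exists2 v : 'rV[F]_d, v != 0 & v *m A = 0.
Proof.
move=> kd; have /rowV0Pn[v vA v0] : kermx A != 0.
  rewrite -mxrank_eq0 mxrank_ker -lt0n subn_gt0.
  exact: leq_ltn_trans (rank_leq_col _) kd.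
by exists v => //; apply/sub_kermxP.
Qed.

(** In an anisotropic space, take nonzero pairwise orthogonal [x], [y], [z] and choose [s], [t] such
    that [s x + t y] takes the value opposite to that of [z]. Then [s x + t y + z] is isotropic, and
    pairing with [z] shows that it is nonzero. *)
Lemma exists_isotropic (F : finFieldType) (d : nat) (G : 'M[F]_d) :
    odd #|F| -> nondeg_form G -> (2 < d)%N ->
  exists2 z, z != 0 & bform G z z = 0.
Proof.
move=> qodd Gn d2.
have [/existsP[z /andP[z0 /eqP zz]]|] := boolP [exists z, (z != 0) && (bform G z z == 0)].
  by exists z.
rewrite negb_exists => /forallP anis.
have {}anis z : z != 0 -> bform G z z != 0 by have := anis z; case: eqP.
(* The map to the zero space has every vector in its kernel, so this only picks a nonzero [x]. *)
have [x x0 _] := @exists_left_kernel _ _ _ (0 : 'M[F]_(d, 0)) (ltn_trans (isT : 0 < 2)%N d2).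
have [y y0 yx] := @exists_left_kernel _ _ _ (G *m x^T) (ltn_trans (isT : 1 < 2)%N d2).
have [z z0] := @exists_left_kernel _ _ _ (row_mx (G *m x^T) (G *m y^T)) d2.
rewrite mul_mx_row => zxy.
have [zx zy] : bform G z x = 0 /\ bform G z y = 0.
  split; rewrite /bform -mulmxA.
    by have := congr1 lsubmx zxy; rewrite row_mxKl => ->; rewrite linear0 mxE.
  by have := congr1 rsubmx zxy; rewrite row_mxKr => ->; rewrite linear0 mxE.
have {}yx : bform G y x = 0 by rewrite /bform -mulmxA yx mxE.
have [s [t st]] := binary_universal (- bform G z z) qodd (anis x x0) (anis y y0).
exists (s *: x + t *: y + z).
  apply: contraNneq (anis z z0) => e.
  have := bform0l G z; rewrite -e !bformE (bformC x) // (bformC y) //.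
  by rewrite zx zy !mulr0 !add0r => ->.
rewrite !bformE !(bformC _ z) // zx zy yx (bformC x) // yx.
rewrite -[bform G z z]opprK -st; ring.
Qed.

Lemma card_set_sum (T : finType) (P : pred T) :
  #|[set x | P x]| = (\sum_x (P x : nat))%N.
Proof. by rewrite -sum1dep_card big_mkcond. Qed.

Lemma card_rV (F : finType) (d : nat) : #|{: 'rV[F]_d}| = (#|F| ^ d)%N.
Proof. by rewrite card_mx mul1n. Qed.

(** The zero vector is included, hence the predecessors in the counts below. *)
Definition isotropic (F : finFieldType) (d : nat) (G : 'M[F]_d) : {set 'rV[F]_d} :=
  [set x | bform G x x == 0].

(** [z] is completed to a hyperbolic pair [z], [w], whose orthogonal complement carries the form
    [S]. The map [f] sends [(a, b, u)] to [a z + b w + u], with [u] in coordinates of the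
    complement. *)
Lemma hyperbolic_split (F : finFieldType) (d : nat) (G : 'M[F]_d) (z : 'rV[F]_d) :
    2%:R != 0 :> F -> nondeg_form G -> (1 < d)%N -> z != 0 -> bform G z z = 0 ->
  exists2 S : 'M[F]_(d - 2), nondeg_form S &
  exists f : F * F * 'rV[F]_(d - 2) -> 'rV[F]_d,
  [/\ bijective f,
      forall t, bform G z (f t) = t.1.2
    & forall t, bform G (f t) (f t) = 2%:R * t.1.1 * t.1.2 + bform S t.2 t.2].
Proof.
move=> F2 Gn d1 z0 zz; have [w1 zw1] := bform_dual Gn z0.
(* This multiple of [z] makes [w] isotropic and leaves the product with [z] equal to 1. *)
pose w := w1 - (bform G w1 w1 / 2%:R) *: z.
have zw : bform G z w = 1 by rewrite /w -scaleNr !bformE zz mulr0 addr0 zw1.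
have ww : bform G w w = 0.
  by rewrite /w -scaleNr !bformE zz (bformC w1) // zw1; field.
clearbody w; have mxB x y : x *m G *m y^T = (bform G x y)%:M by rewrite -mx11_scalar.
have Yu : col_mx z w *m G *m (col_mx z w)^T \in unitmx.
  have -> : col_mx z w *m G *m (col_mx z w)^T = block_mx 0 1%:M 1%:M 0.
    rewrite tr_col_mx mul_col_mx mul_col_row !mxB (bformC w) // zz zw ww.
    by rewrite raddf0.
  (* The Gram matrix of a hyperbolic pair is its own inverse. *)
  have := @mulmx1_unit F (1 + 1) (block_mx 0 1%:M 1%:M 0) (block_mx 0 1%:M 1%:M 0).
  case=> //; rewrite mulmx_block !mul0mx !mul1mx !add0r ?addr0 ?mulmx0.
  by rewrite -scalar_mx_block.
have [R RY Sn] := nondeg_perp Gn Yu.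
exists (R *m G *m R^T) => //.
move: RY; rewrite tr_col_mx mul_mx_row => RY.
have Rz u : bform G (u *m R) z = 0.
  rewrite /bform -!mulmxA (mulmxA R).
  have := congr1 lsubmx RY; rewrite row_mxKl => ->.
  by rewrite linear0 mulmx0 mxE.
have Rw u : bform G (u *m R) w = 0.
  rewrite /bform -!mulmxA (mulmxA R).
  have := congr1 rsubmx RY; rewrite row_mxKr => ->.
  by rewrite linear0 mulmx0 mxE.
pose f (t : F * F * 'rV[F]_(d - 2)) := t.1.1 *: z + t.1.2 *: w + t.2 *m R.
have fz t : bform G z (f t) = t.1.2.
  by rewrite /f !bformE zz zw (bformC _ (_ *m R)) // Rz mulr0 add0r mulr1 addr0.
have fw t : bform G w (f t) = t.1.1.
  by rewrite /f !bformE ww (bformC w) // zw (bformC _ (_ *m R)) // Rw mulr0 mulr1 !addr0.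
exists f; split=> //.
  apply: inj_card_bij; last first.
    rewrite !card_prod !card_rV -mulnA -!expnS.
    by have -> : (d - 2).+2 = d by lia.
  move=> [[a b] u] [[a' b'] u'] e.
  have := congr1 (bform G z) e; rewrite !fz /= => eb.
  have := congr1 (bform G w) e; rewrite !fw /= => ea.
  move: e; rewrite /f /= ea eb => /addrI eR; congr (_, _, _).
  have [_ Su] := andP Sn; apply: (can_inj (mulmxK Su)).
  by rewrite !mulmxA eR.
move=> t; rewrite {1}/f bformDl bformDl !bformZl fz fw /f !bformE Rz Rw bform_pull.
ring.
Qed.

(** The order of summation suits [2 a b + S(u,u) = 0]: the cases are on [b], and for fixed [b] and
    [u] the equation is linear in [a]. *)
Lemma sum_triple (A B C : finType) (g : A * B * C -> nat) :
  (\sum_t g t = \sum_b \sum_c \sum_a g (a, b, c))%N.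
Proof.
transitivity (\sum_a \sum_b \sum_c g (a, b, c))%N.
  by rewrite pair_bigA pair_bigA /=; apply: eq_bigr => [[[a b] c]].
by rewrite exchange_big; apply: eq_bigr => b _; rewrite exchange_big.
Qed.

Lemma card_set_bij (A B : finType) (f : A -> B) (P : pred B) :
  bijective f -> #|[set b | P b]| = (\sum_a (P (f a) : nat))%N.
Proof.
by move=> fb; rewrite card_set_sum (reindex f) //; apply: onW_bij.
Qed.

(** In hyperbolic coordinates the equation is [2 a b + S(u,u) = 0]. If [b] is nonzero, then [b] and
    [u] determine [a]; if [b = 0], then [a] is free and [u] is isotropic. The hyperplane orthogonal
    to [z] is [b = 0]. *)
Lemma card_isotropic_perp (F : finFieldType) (d : nat) (G : 'M[F]_d) (z : 'rV[F]_d) :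
    2%:R != 0 :> F -> nondeg_form G -> (1 < d)%N -> z != 0 -> bform G z z = 0 ->
  [/\ #|[set x | bform G z x == 0]| = (#|F| ^ d.-1)%N
    & exists2 S : 'M[F]_(d - 2), nondeg_form S &
      #|isotropic G| = (#|F|.-1 * #|F| ^ (d - 2) + #|F| * #|isotropic S|)%N /\
      #|[set x in isotropic G | bform G z x == 0]| = (#|F| * #|isotropic S|)%N].
Proof.
move=> F2 Gn d1 z0 zz.
have [S Sn [f [fb fz fQ]]] := hyperbolic_split F2 Gn d1 z0 zz.
have sum0 (D : finType) (g : F -> D -> nat) :
    (\sum_b \sum_c \sum_(a in F) (b == 0%R) * g b c = #|F| * \sum_c g 0%R c)%N.
  rewrite (bigD1 0%R) //= [X in (_ + X)%N]big1 ?addn0; last first.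
    by move=> b /negPf b0; rewrite big1 // => c _; rewrite b0 sum_nat_const muln0.
  by rewrite big_distrr; apply: eq_bigr => c _; rewrite sum_nat_const eqxx mul1n.
split.
  rewrite (card_set_bij _ fb) sum_triple.
  under eq_bigr => b _ do under eq_bigr => c _ do under eq_bigr => a _ do
    rewrite fz /= -[nat_of_bool _]muln1.
  rewrite (sum0 _ (fun _ _ => 1%N)) sum_nat_const muln1 card_rV -expnS; congr (_ ^ _)%N.
  lia.
exists S => //; split.
  rewrite (card_set_bij _ fb) sum_triple (bigD1 0%R) //= addnC; congr (_ + _)%N.
    rewrite -(cardC1 (0 : F)) -card_rV -sum_nat_const.
    apply: eq_bigr => b b0; rewrite -sum1_card; apply: eq_bigr => c _.
    rewrite (bigD1 (- bform S c c / (2%:R * b))) //= big1 ?addn0.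
      rewrite fQ /= (_ : _ + _ = 0) ?eqxx //; field.
      by rewrite b0 F2.
    move=> a ha; rewrite fQ /=; apply/eqP; rewrite eqb0; apply: contraNneq ha => e.
    apply/eqP; rewrite -[X in - X](addKr (2%:R * a * b)) e; field.
    by rewrite b0 F2.
  rewrite card_set_sum big_distrr /=; apply: eq_bigr => c _.
  rewrite -sum_nat_const; apply: eq_bigr => a _.
  by rewrite fQ /= mulr0 add0r.
rewrite (card_set_bij _ fb) sum_triple.
under eq_bigr => b _ do under eq_bigr => c _ do under eq_bigr => a _ do
  rewrite inE fz fQ /= andbC -mulnb.
transitivity (\sum_(b in F) \sum_c \sum_(a in F) (b == 0%R :> F) * (bform S c c == 0%R))%N.
  apply: eq_bigr => b _; apply: eq_bigr => c _; apply: eq_bigr => a _.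
  by case: eqP => // ->; rewrite mulr0 add0r.
by rewrite (sum0 _ (fun _ c => nat_of_bool (bform S c c == 0%R))) -card_set_sum.
Qed.

(** Hyperbolic planes are split off until dimension 1, where only 0 is isotropic. In even dimension
    the number would depend on the type of the form, so the plane counts below treat the two
    parities differently. *)
Lemma card_isotropic_odd (F : finFieldType) (d : nat) (G : 'M[F]_d) :
    odd #|F| -> nondeg_form G -> odd d ->
  #|isotropic G| = (#|F| ^ d.-1)%N.
Proof.
move=> qodd; have F2 := finField_2neq0 qodd.
elim/ltn_ind: d G => d IH G Gn dodd.
have [d2|] := ltnP 2 d; last first.
  move=> d2; have d1 : d = 1%N by lia.
  subst d; rewrite expn0; apply/eqP/cards1P; exists 0; apply/finset.setP=> x.
  rewrite !inE; apply/eqP/eqP => [|->]; last exact: bform0l.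
  rewrite (mx11_scalar x) -(scalemx1 _ (x 0 0)).
  rewrite !bformE; have [y y1] := bform_dual Gn (oner_neq0 _ : (1%:M : 'rV[F]_1) != 0).
  move: y1; rewrite (mx11_scalar y) -(scalemx1 _ (y 0 0)) bformZr => y1 /eqP.
  have /negPf B0 : bform G 1%:M 1%:M != 0.
    by apply: contra_eq_neq y1 => ->; rewrite mulr0 eq_sym oner_eq0.
  by rewrite !mulf_eq0 B0 !orbF orbb => /eqP->; rewrite scale0r.
have [z z0 zz] := exists_isotropic qodd Gn d2.
have [_ [S Sn [-> _]]] := card_isotropic_perp F2 Gn (ltnW d2) z0 zz.
rewrite IH //; [|lia|by rewrite oddB ?dodd; lia].
have -> : d.-1 = (d - 2).+1 by lia.
rewrite -expnS; have -> : (d - 2).-1.+1 = (d - 2)%N by lia.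
rewrite -mulSnr prednK ?expnS //; apply/card_gt0P; exists 0; by [].
Qed.

(** * Nondegenerate planes *)

Definition gram_singular (F : finFieldType) (d : nat) (G : 'M[F]_d) (x y : 'rV[F]_d) : bool :=
  bform G x x * bform G y y == bform G x y ^+ 2.

(* y = a x + z with z orthogonal to x, and the Gram determinant of x and y is
   the product of the values of the form at x and z. *)
Lemma card_gram_singular_anis (F : finFieldType) (d : nat) (G : 'M[F]_d) (x : 'rV[F]_d) :
    nondeg_form G -> bform G x x != 0 ->
  #|[set y | gram_singular G x y]| =
  (#|F| * #|[set z in isotropic G | bform G x z == 0%R]|)%N.
Proof.
move=> Gn xx; set A := [set z in _ | _].
have cE : #|finset.setX [set: F] A| = (#|F| * #|A|)%N by rewrite cardsX cardsT.
pose f (p : F * 'rV[F]_d) := p.1 *: x + p.2.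
rewrite -cE -(card_in_imset (f := f)); last first.
  move=> [a u] [b v]; rewrite !inE /= => /andP[_ /eqP xu] /andP[_ /eqP xv] e.
  have := congr1 (bform G x) e; rewrite /f /= !bformE xu xv !addr0 => /(mulIf xx) ab.
  by move: e; rewrite /f /= ab => /addrI ->.
apply: eq_card => y; rewrite inE; apply/idP/imsetP => [/eqP sy|[[a z]]]; last first.
  rewrite !inE /= => /andP[/eqP zz /eqP xz] ->.
  rewrite /gram_singular /f /= !bformE zz xz (bformC z) // xz.
  by apply/eqP; ring.
exists (bform G x y / bform G x x, y - (bform G x y / bform G x x) *: x); last first.
  by rewrite /f /= addrC subrK.
rewrite !inE /= -scaleNr !bformE (bformC y) //; apply/andP; split; apply/eqP.
  transitivity ((bform G x x * bform G y y - bform G x y ^+ 2) / bform G x x).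
    by field.
  by rewrite sy subrr mul0r.
by field.
Qed.

Lemma card_gram_singular_isotropic (F : finFieldType) (d : nat) (G : 'M[F]_d)
    (x : 'rV[F]_d) :
    2%:R != 0 :> F -> nondeg_form G -> (1 < d)%N -> x != 0 -> bform G x x = 0 ->
  #|[set y | gram_singular G x y]| = (#|F| ^ d.-1)%N.
Proof.
move=> F2 Gn d1 x0 xx; have [<- _] := card_isotropic_perp F2 Gn d1 x0 xx.
by apply: eq_card => y; rewrite !inE /gram_singular xx mul0r eq_sym sqrf_eq0.
Qed.

(** The three terms come from [x = 0], from the other isotropic [x], and from the anisotropic
    [x]. *)
Lemma card_gram_singular (F : finFieldType) (d : nat) (G : 'M[F]_d) :
    2%:R != 0 :> F -> nondeg_form G -> (1 < d)%N ->
  (\sum_x #|[set y | gram_singular G x y]| =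
   #|F| ^ d + #|isotropic G|.-1 * #|F| ^ d.-1
   + #|F| * \sum_(x in ~: isotropic G) #|[set z in isotropic G | bform G x z == 0%R]|)%N.
Proof.
move=> F2 Gn d1; rewrite (bigID (mem (isotropic G))) /=; congr (_ + _)%N.
  have i0 : 0 \in isotropic G by rewrite inE bform0l.
  rewrite (bigD1 0) //=; congr (_ + _)%N.
    rewrite -card_rV -cardsT; apply: eq_card => y.
    by rewrite !inE /gram_singular !bform0l mul0r expr0n eqxx.
  rewrite (cardsD1 0) i0 add1n succnK -sum_nat_const.
  under eq_bigr => x /andP[].
    rewrite inE => /eqP xx x0; rewrite card_gram_singular_isotropic //; over.
  by apply: eq_bigl => x; rewrite !inE andbC.
rewrite big_distrr /=; apply: eq_big => x; rewrite !inE // => xx.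
exact: card_gram_singular_anis.
Qed.

(** The complement of an anisotropic vector is nondegenerate, and [S] is the form on it. *)
Lemma card_isotropic_perp_anis (F : finFieldType) (d : nat) (G : 'M[F]_d) (x : 'rV[F]_d) :
    nondeg_form G -> (0 < d)%N -> bform G x x != 0 ->
  exists2 S : 'M[F]_(d - 1), nondeg_form S &
    #|[set z in isotropic G | bform G x z == 0]| = #|isotropic S|.
Proof.
move=> Gn d0 xx.
have xu : x *m G *m x^T \in unitmx.
  by rewrite (mx11_scalar (_ *m _)) -/(bform G x x) unitmxE det_scalar1 unitfE.
have [R Rx Sn] := nondeg_perp Gn xu; exists (R *m G *m R^T) => //.
have [_ Su] := andP Sn.
have Rinj : injective (mulmx^~ R : 'rV_(d - 1) -> 'rV_d).
  move=> u v e; apply: (can_inj (mulmxK Su)).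
  by rewrite !mulmxA e.
have xR u : bform G x (u *m R) = 0.
  by rewrite bformC // /bform -!mulmxA (mulmxA R) Rx mulmx0 mxE.
pose f (p : F * 'rV[F]_(d - 1)) := p.1 *: x + p.2 *m R.
have finj : injective f.
  move=> [a u] [b v] e; have := congr1 (bform G x) e.
  rewrite /f /= !bformE !xR !addr0 => /(mulIf xx) ab.
  by move: e; rewrite /f /= ab => /addrI/Rinj ->.
have [g _ gK] : bijective f.
  apply: inj_card_bij => //; rewrite card_prod !card_rV -expnS.
  by have -> : (d - 1).+1 = d by lia.
rewrite -(card_imset _ Rinj); apply: eq_card => z; rewrite !inE.
apply/andP/imsetP => [[/eqP zz /eqP xz]|[u]].
  have a0 : (g z).1 = 0.
    have := congr1 (bform G x) (gK z); rewrite {1}/f !bformE xR xz addr0.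
    by move/eqP; rewrite mulf_eq0 (negPf xx) orbF => /eqP.
  have zE : z = (g z).2 *m R by rewrite -{1}(gK z) /f a0 scale0r add0r.
  by exists (g z).2; rewrite // inE -bform_pull -zE zz.
by rewrite inE -bform_pull => uu ->; rewrite uu xR.
Qed.

Lemma det_mx22 (R : comNzRingType) (M : 'M[R]_2) :
  \det M = M 0 0 * M 1 1 - M 0 1 * M 1 0.
Proof.
rewrite (expand_det_row _ 0) !big_ord_recl big_ord0 /cofactor !det_mx11 !mxE.
rewrite addr0 /= expr0 mul1r expr1 mulN1r mulrN.
by congr (_ * M _ _ - M _ _ * M _ _); apply/val_inj.
Qed.

(** A 2 by d matrix is a pair of rows. Either it is a frame of a nondegenerate plane, or its Gram
    determinant vanishes. *)
Lemma card_nondeg_pairs (F : finFieldType) (d : nat) (G : 'M[F]_d) :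
    nondeg_form G ->
  (#|sadj_idem G 2| * #|units_mx F 2| + \sum_x #|[set y | gram_singular G x y]|
   = #|F| ^ (2 * d))%N.
Proof.
move=> Gn; rewrite -card_nondeg_frames //.
have -> : (#|F| ^ (2 * d))%N = #|{: 'M[F]_(2, d)}| by rewrite card_mx.
rewrite -(cardsC [set X : 'M[F]_(2, d) | X *m G *m X^T \in unitmx]); congr (_ + _)%N.
pose f (X : 'M[F]_(2, d)) := (row 0 X, row 1 X).
have fb : bijective f.
  apply: inj_card_bij; last first.
    by rewrite card_prod !card_rV card_mx -expnD addnn -mul2n.
  move=> X Y [e0 e1]; apply/row_matrixP=> i.
  by case: (unliftP 0 i) => [j|] -> //; rewrite ord1 (_ : lift 0 0 = 1) //; apply/val_inj.
rewrite (_ : ~: _ = [set X | gram_singular G (f X).1 (f X).2]); last first.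
  apply/finset.setP=> X; rewrite !inE unitmxE unitfE negbK det_mx22 subr_eq0 /gram_singular.
  have E i j : (X *m G *m X^T) i j = bform G (row i X) (row j X).
    by rewrite /bform -row_mul !mxE; apply: eq_bigr => k _; rewrite !mxE.
  by rewrite !E (bformC (row 1 X)) // expr2.
rewrite card_set_sum.
under eq_bigr => x _ do rewrite card_set_sum.
rewrite pair_bigA /= (reindex f) //; exact: onW_bij.
Qed.

Lemma card_units_mx2 (F : finFieldType) :
  #|units_mx F 2| = (#|F| * #|F|.-1 ^ 2 * #|F|.+1)%N.
Proof.
rewrite -card_GL_2 [RHS]cardsT /= card_sub.
by apply: eq_card => h; rewrite !inE.
Qed.

(** The complement of an anisotropic vector has odd dimension, so its isotropic vectors number
    [q^(d-2)]. Hence every nonzero [x], isotropic or not, forms a singular pair with exactly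
    [q^(d-1)] vectors, and the unknown number of isotropic vectors cancels. *)
Lemma card_sadj_idem2_even (F : finFieldType) (d : nat) (G : 'M[F]_d) :
    odd #|F| -> nondeg_form G -> ~~ odd d -> (1 < d)%N ->
  (#|sadj_idem G 2| * (#|F|.-1 * #|F|.+1) = #|F| ^ (d - 2) * (#|F| ^ d).-1)%N.
Proof.
move=> qodd Gn dev d1; have F2 := finField_2neq0 qodd.
have := card_nondeg_pairs Gn; rewrite card_gram_singular // card_units_mx2.
rewrite (eq_bigr (fun=> #|F| ^ (d - 2))%N); last first.
  move=> x; rewrite !inE => xx.
  have [S Sn ->] := card_isotropic_perp_anis Gn (ltnW d1) xx.
  rewrite (card_isotropic_odd qodd Sn); last by rewrite oddB ?(negPf dev) // ltnW.
  by congr (_ ^ _)%N; lia.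
rewrite sum_nat_const.
have i0 : (0 < #|isotropic G|)%N.
  by apply/card_gt0P; exists 0; rewrite inE bform0l.
have := cardsC (isotropic G); rewrite card_rV.
have [p pE] : {p | #|F| = p.+2}.
  by exists (#|F| - 2)%N; rewrite -[LHS](subnKC (card_finNzRing_gt1 F)).
have dE : d = (d - 2).+2 by lia.
have -> : d.-1 = (d - 2).+1 by lia.
rewrite (mulnC 2) expnM.
have -> : (#|F| ^ d = #|F| * (#|F| * #|F| ^ (d - 2)))%N by rewrite {1}dE !expnS.
rewrite (expnS _ (d - 2)).
have : (0 < #|F| ^ (d - 2))%N by rewrite expn_gt0 pE.
move: (#|F| ^ (d - 2))%N #|isotropic G| #|~: isotropic G| #|sadj_idem G 2| i0.
rewrite {}pE => D [] // z y N _ D0 /= zy h.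
(* The order of GL_2 is [q (q-1)^2 (q+1)], so the claim is multiplied by [q (q-1)]. *)
apply/eqP; rewrite -(eqn_pmul2l (isT : 0 < p.+2 * p.+1)%N); apply/eqP.
have [e eE] : exists e, (p.+2 * (p.+2 * D) = e.+1)%N.
  by exists (p.+2 * (p.+2 * D)).-1%N; rewrite prednK // !muln_gt0.
rewrite eE /= in h zy *.
(* [z] counts the nonzero isotropic vectors, [y] the anisotropic ones, and [e] is [q^d - 1]. *)
have yz : (z + y = e)%N by lia.
apply: (@addIn (p.+2 * D * e)%N); apply: (@addIn e.+1).
transitivity (e.+1 ^ 2)%N; first by rewrite -h -yz; ring.
by rewrite -mulnn mulSn addnC -{1}eE; congr (_ + _)%N; ring.
Qed.

(** The complement of [x] now has even dimension, where the count depends on the type, so the pairs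
    are counted from the side of [z]. All anisotropic [x] are orthogonal to [z = 0]; a nonzero [z]
    leaves [q^(d-1) - q q^(d-3)] of them. *)
Lemma card_anis_isotropic_orth (F : finFieldType) (d : nat) (G : 'M[F]_d) :
    odd #|F| -> nondeg_form G -> odd d -> (2 < d)%N ->
  (\sum_(x in ~: isotropic G) #|[set z in isotropic G | bform G x z == 0%R]| =
   #|F|.-1 * #|F| ^ d.-1 + (#|F| ^ d.-1).-1 * (#|F|.-1 * #|F| ^ (d - 2)))%N.
Proof.
move=> qodd Gn dodd d2; have F2 := finField_2neq0 qodd.
have q0 : (0 < #|F|)%N by apply/card_gt0P; exists 0.
have cI := card_isotropic_odd qodd Gn dodd.
under eq_bigr => x _ do rewrite -sum1_card.
rewrite (exchange_big_dep (mem (isotropic G))) /=; last first.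
  by move=> x z _; rewrite inE => /andP[].
transitivity (\sum_(z in isotropic G) #|[set x in ~: isotropic G | bform G z x == 0%R]|)%N.
  apply: eq_bigr => z zI; rewrite -sum1_card; apply: eq_bigl => x.
  by rewrite !inE in zI *; rewrite zI bformC.
have i0 : 0 \in isotropic G by rewrite inE bform0l.
rewrite (bigD1 0) //=; congr (_ + _)%N.
  have -> : [set x in ~: isotropic G | bform G 0 x == 0] = ~: isotropic G.
    by apply/finset.setP=> x; rewrite inE bform0l eqxx andbT.
  have := cardsC (isotropic G); rewrite card_rV cI.
  have -> : (#|F| ^ d = #|F|.-1 * #|F| ^ d.-1 + #|F| ^ d.-1)%N.
    by rewrite -mulSnr prednK // -expnS prednK //; lia.
  by rewrite addnC => /addIn.
have -> : (#|F| ^ d.-1).-1 = #|isotropic G :\ 0|.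
  by rewrite -cI (cardsD1 0) i0.
rewrite -sum_nat_const.
rewrite [RHS](eq_bigl (fun z => (z \in isotropic G) && (z != 0))); last first.
  by move=> z; rewrite !inE andbC.
apply: eq_bigr => z /andP[zI z0]; rewrite inE in zI.
have [c0 [S Sn [_ c1]]] := card_isotropic_perp F2 Gn (ltnW d2) z0 (eqP zI).
have cS := card_isotropic_odd qodd Sn.
rewrite cS in c1; last by rewrite oddB ?dodd // ltnW.
have c3 := cardsID (isotropic G) [set x | bform G z x == 0].
have s1 : [set x | bform G z x == 0] :&: isotropic G
    = [set x in isotropic G | bform G z x == 0].
  by apply/finset.setP=> x; rewrite !inE andbC.
have s2 : [set x | bform G z x == 0] :\: isotropic G
    = [set x in ~: isotropic G | bform G z x == 0].
  by apply/finset.setP=> x; rewrite !inE andbC.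
move: c3; rewrite s1 s2 c0 c1 -expnS.
have -> : (d - 2).-1.+1 = (d - 2)%N by clear -d2; lia.
have -> : (#|F| ^ d.-1 = #|F|.-1 * #|F| ^ (d - 2) + #|F| ^ (d - 2))%N.
  rewrite -mulSnr prednK // -expnS; congr (_ ^ _)%N; clear -d2; lia.
by rewrite addnC => /addIn.
Qed.

Lemma card_sadj_idem2_odd (F : finFieldType) (d : nat) (G : 'M[F]_d) :
    odd #|F| -> nondeg_form G -> odd d -> (2 < d)%N ->
  (#|sadj_idem G 2| * (#|F|.-1 * #|F|.+1) = #|F| ^ d.-1 * (#|F| ^ d.-1).-1)%N.
Proof.
move=> qodd Gn dodd d2; have F2 := finField_2neq0 qodd.
have := card_nondeg_pairs Gn; rewrite card_gram_singular ?(ltnW d2) // card_units_mx2.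
rewrite card_anis_isotropic_orth // (card_isotropic_odd qodd Gn dodd).
have [p pE] : {p | #|F| = p.+2}.
  by exists (#|F| - 2)%N; rewrite -[LHS](subnKC (card_finNzRing_gt1 F)).
have dE : d = (d - 2).+2 by lia.
rewrite (mulnC 2) expnM.
have -> : (#|F| ^ d = #|F| * (#|F| * #|F| ^ (d - 2)))%N by rewrite {1}dE !expnS.
have -> : d.-1 = (d - 2).+1 by lia.
rewrite (expnS _ (d - 2)).
have : (0 < #|F| ^ (d - 2))%N by rewrite expn_gt0 pE.
move: (#|F| ^ (d - 2))%N #|sadj_idem G 2|; rewrite {}pE /= => D N D0 h.
have [e eE] : exists e, (p.+2 * D = e.+1)%N.
  by exists (p.+2 * D).-1%N; rewrite prednK // !muln_gt0.
apply/eqP; rewrite -(eqn_pmul2l (isT : 0 < p.+2 * p.+1)%N); apply/eqP.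
rewrite eE /= in h *.
(* The added term is the number of singular pairs, with [e = q^(d-1) - 1]. *)
apply: (@addIn (p.+2 * e.+1 + e * e.+1 + p.+2 * (p.+1 * e.+1 + e * (p.+1 * D)))%N).
transitivity ((p.+2 * e.+1) ^ 2)%N; first by rewrite -h; ring.
have -> : (p.+2 * (p.+1 * e.+1 + e * (p.+1 * D)) = p.+2 * (p.+1 * e.+1) + e * (p.+1 * e.+1))%N.
  by rewrite -eE; ring.
ring.
Qed.

(** * Nondegenerate subspaces of even dimension and q-binomial coefficients *)

Definition qpoch (R : nzRingType) (w : R) (n : nat) : R :=
  \prod_(i < n) (1 - w ^+ i.+1).

(* Meaningful for k <= n only: n - k is truncated. *)
Definition qbinom (R : fieldType) (w : R) (n k : nat) : R :=
  qpoch w n / (qpoch w k * qpoch w (n - k)).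

Lemma qpochS (R : nzRingType) (w : R) (n : nat) :
  qpoch w n.+1 = qpoch w n * (1 - w ^+ n.+1).
Proof. by rewrite /qpoch big_ord_recr. Qed.

Lemma sadj_idem0 (F : finFieldType) (d : nat) (G : 'M[F]_d) : sadj_idem G 0 = [set 0].
Proof.
apply/finset.setP=> P; rewrite inE finset.in_set1 mxrank_eq0.
case: (P =P 0) => [->|]; last by rewrite !andbF.
by rewrite mulmx0 mul0mx trmx0 mulmx0 !eqxx.
Qed.

(** Induction on [k] with flags whose smaller member is a plane: the complement of a plane again has
    odd dimension, with [n] lowered by 1. The parameter of the q-binomial is [q^-2] rather than
    [q^2], so that it converges as [n] grows. *)
Lemma card_sadj_idem_even_rank (R : numFieldType) (F : finFieldType) (n k : nat)
    (G : 'M[F]_(n.*2.+1)) :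
    odd #|F| -> nondeg_form G -> (k <= n)%N ->
  #|sadj_idem G k.*2|%:R =
  (#|F|%:R ^+ 2) ^+ (2 * (k * (n - k)) + k) * qbinom (#|F|%:R ^- 2) n k :> R.
Proof.
move=> qodd; set q : R := #|F|%:R; set Q := q ^+ 2; set w := q ^- 2.
have q1 : 1 < q by rewrite ltr1n card_finNzRing_gt1.
have q0 : q != 0 by rewrite gt_eqF // (lt_trans ltr01).
have Q0 : Q != 0 by rewrite expf_neq0.
have w1 i : w ^+ i.+1 != 1.
  by rewrite /w exprVn invr_eq1 gt_eqF // exprn_egt1 // exprn_egt1.
have P0 i : qpoch w i != 0.
  by apply/prodf_neq0 => j _; rewrite subr_eq0 eq_sym w1.
elim: k n G => [|k IH] n G Gn kn.
  rewrite sadj_idem0 cards1 mul0n muln0 expr0 mul1r /qbinom subn0 /qpoch big_ord0 mul1r.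
  by rewrite divff // P0.
case: n G Gn kn => // n G Gn kn.
have predR m : (0 < m)%N -> m.-1%:R = m%:R - 1 :> R by move=> m0; rewrite -subn1 natrB.
have nq0 : (0 < #|F|)%N by apply/card_gt0P; exists 0.
have qXQ i : (#|F| ^ i.*2)%N%:R = Q ^+ i :> R by rewrite natrX -mul2n exprM.
have Q1 : Q - 1 != 0 by rewrite subr_eq0 gt_eqF // exprn_egt1.
(* Common shape of the two plane counts, even and odd dimension, in terms of [Q]. *)
have cast2 (N m l : nat) :
    (N * (#|F|.-1 * #|F|.+1) = #|F| ^ l.*2 * (#|F| ^ m.*2).-1)%N ->
    N%:R = Q ^+ l * (Q ^+ m - 1) / (Q - 1) :> R.
  move/(congr1 (fun m => m%:R : R)); rewrite !natrM -[#|F|.+1]addn1 natrD.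
  rewrite !predR ?expn_gt0 ?nq0 // !qXQ -/q => h; apply: (canRL (mulfK Q1)).
  by rewrite -h /Q; ring.
have evenE (S : 'M[F]_k.+1.*2) : nondeg_form S ->
    #|sadj_idem S 2|%:R = Q ^+ k * (Q ^+ k.+1 - 1) / (Q - 1).
  by move=> Sn; apply: cast2; rewrite card_sadj_idem2_even ?odd_double // doubleS subn2.
have restE (S : 'M[F]_(n.+1.*2.+1 - 2)) : nondeg_form S ->
    #|sadj_idem S (k.+1.*2 - 2)|%:R = Q ^+ (2 * (k * (n - k)) + k) * qbinom w n k.
  move=> Sn; rewrite (_ : k.+1.*2 - 2 = k.*2)%N; first exact: (IH n S Sn kn).
  by rewrite doubleS subn2.
have := sadj_idem_flags Gn (isT : 2 <= k.+1.*2)%N evenE restE.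
have -> : #|sadj_idem G 2|%:R = Q ^+ n.+1 * (Q ^+ n.+1 - 1) / (Q - 1).
  by apply: cast2; rewrite card_sadj_idem2_odd //= ?odd_double.
have y0 i : Q ^+ i.+1 - 1 != 0 by rewrite subr_eq0 gt_eqF // exprn_egt1 // exprn_egt1.
have a0 : Q ^+ k * (Q ^+ k.+1 - 1) / (Q - 1) != 0.
  by rewrite !mulf_neq0 ?invr_neq0 ?expf_neq0.
move=> h; apply: (mulIf a0); rewrite {}h subSS.
have kn' : (k <= n)%N by [].
rewrite /qbinom !qpochS subSS.
have wE i : w ^+ i = (Q ^+ i)^-1 by rewrite /w exprVn.
rewrite !wE; have Pn0 := P0 n; have Pk0 := P0 k; have Pnk0 := P0 (n - k)%N.
have := y0 k; have := y0 n; move: (n - k)%N (subnKC kn') Pnk0 => m <- Pnk0.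
have -> : Q ^+ (k + m).+1 = Q ^+ k * Q ^+ m * Q by rewrite exprSr exprD.
have -> : Q ^+ (2 * (k.+1 * m) + k.+1) = Q ^+ (2 * (k * m) + k) * Q ^+ m * Q ^+ m * Q.
  by rewrite -!exprD -exprSr; congr (_ ^+ _); ring.
rewrite (exprSr _ k).
have [z0 u0] : Q ^+ k != 0 /\ Q ^+ m != 0 by rewrite !expf_neq0.
move: (qpoch w _) (qpoch w k) (qpoch w m) Pn0 Pk0 Pnk0 => A B C A0 B0 C0.
move: (Q ^+ k) (Q ^+ m) (Q ^+ (2 * _ + _)) z0 u0 => z u t z0 u0 x1 y1.
field.
by rewrite Q1 Q0 z0 C0 y1 B0 u0.
Qed.

(** * Involutions of SO(2n+1,q) *)

(** The block matrix with rows [1, A] and [B, 1] has two triangular factorizations, one for each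
    Schur complement. *)
Lemma det_1subM (R : comNzRingType) (m n : nat) (A : 'M[R]_(m, n)) (B : 'M[R]_(n, m)) :
  \det (1%:M - A *m B) = \det (1%:M - B *m A).
Proof.
pose M : 'M[R]_(m + n) := block_mx 1%:M A B 1%:M.
have M1 : M = block_mx 1%:M 0 B 1%:M *m block_mx 1%:M A 0 (1%:M - B *m A).
  by rewrite mulmx_block !mul1mx !mul0mx !mulmx1 ?mulmx0 !addr0 addrC subrK.
have M2 : M = block_mx 1%:M A 0 1%:M *m block_mx (1%:M - A *m B) 0 B 1%:M.
  by rewrite mulmx_block !mul1mx !mul0mx !mulmx1 ?mulmx0 !add0r subrK.
have := congr1 determinant M1; rewrite {1}M2 !det_mulmx !det_lblock !det_ublock !det1.
by rewrite !mulr1 !mul1r.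
Qed.

(** With [P = C R] and [R C = 1], the determinant becomes that of [1 - 2 = -1] in dimension
    [\rank P]. *)
Lemma det_1sub2_idem (F : fieldType) (d : nat) (P : 'M[F]_d) :
  P *m P = P -> \det (1%:M - 2%:R *: P) = (-1) ^+ \rank P.
Proof.
move=> PP; have [C [R PE RC]] := idem_factor PP erefl.
rewrite {1}PE scalemxAl det_1subM -scalemxAr RC.
have -> : 1%:M - 2%:R *: 1%:M = - 1%:M :> 'M[F]_(\rank P).
  by rewrite scaler_nat mulr2n opprD addrA subrr sub0r.
by rewrite -scaleN1r detZ det1 mulr1.
Qed.

(* The Gram matrix of the polar form, so bform (oddG F n) x x is twice oddQ x. *)
Definition oddG (F : fieldType) (n : nat) : 'M[F]_(n.*2.+1) :=
  \sum_(i < n) (delta_mx (inord i.*2) (inord i.*2.+1)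
                + delta_mx (inord i.*2.+1) (inord i.*2))
  + 2%:R *: delta_mx ord_max ord_max.

Lemma bform_delta_mx (F : fieldType) (d : nat) (i j : 'I_d) (x y : 'rV[F]_d) :
  bform (delta_mx i j) x y = x 0 i * y 0 j.
Proof.
rewrite /bform -mulmxA -(mul_delta_mx (0 : 'I_1)) -!mulmxA -rowE mulmxA -colE.
by rewrite mxE big_ord1 !mxE.
Qed.

Lemma bform_oddG (F : fieldType) (n : nat) (x y : 'rV[F]_(n.*2.+1)) :
  bform (oddG F n) x y =
  \sum_(i < n) (x 0 (inord i.*2) * y 0 (inord i.*2.+1)
                + x 0 (inord i.*2.+1) * y 0 (inord i.*2))
  + 2%:R * (x 0 ord_max * y 0 ord_max).
Proof.
have bD A B : bform (A + B) x y = bform A x y + bform B x y.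
  by rewrite /bform mulmxDr mulmxDl mxE.
rewrite /oddG bD; congr (_ + _); last first.
  by rewrite /bform -scalemxAr -scalemxAl mxE -/(bform _ x y) bform_delta_mx.
have -> : bform (\sum_(i < n) (delta_mx (inord i.*2) (inord i.*2.+1)
    + delta_mx (inord i.*2.+1) (inord i.*2))) x y = \sum_(i < n)
    bform (delta_mx (inord i.*2) (inord i.*2.+1) + delta_mx (inord i.*2.+1) (inord i.*2)) x y.
  apply: (big_morph (fun A => bform A x y) bD).
  by rewrite /bform mulmx0 mul0mx mxE.
by apply: eq_bigr => i _; rewrite bD !bform_delta_mx.
Qed.

Lemma bform_oddQ (F : finFieldType) (n : nat) (x : 'rV[F]_(n.*2.+1)) :
  bform (oddG F n) x x = 2%:R * oddQ x.
Proof.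
rewrite bform_oddG /oddQ mulrDr -expr2 big_distrr /=; congr (_ + _).
by apply: eq_bigr => i _; ring.
Qed.

(** Pairing a radical vector with a basis vector isolates one coordinate: the hyperbolic partner, or
    twice the last coordinate. *)
Lemma oddG_nondeg (F : fieldType) (n : nat) :
  2%:R != 0 :> F -> nondeg_form (oddG F n).
Proof.
move=> F2; apply/andP; split.
  rewrite /oddG linearD linearZ linear_sum /= trmx_delta; apply/eqP.
  by congr (_ + _); apply: eq_bigr => i _; rewrite linearD /= !trmx_delta addrC.
rewrite -row_free_unit; apply: inj_row_free => x xG.
have xy y : bform (oddG F n) x y = 0 by rewrite /bform xG mul0mx mxE.
have iE a b : (a <= n.*2)%N -> (b <= n.*2)%N ->
    (inord a == inord b :> 'I_(n.*2.+1)) = (a == b).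
  by move=> an bn; rewrite -val_eqE /= !inordK.
have mE : ord_max = inord n.*2 :> 'I_(n.*2.+1) by apply/val_inj; rewrite /= inordK.
have xp (p : nat) : (p <= n.*2)%N -> 0 = \sum_(i < n) (x 0 (inord i.*2) * (i.*2.+1 == p)%:R
     + x 0 (inord i.*2.+1) * (i.*2 == p)%:R) + 2%:R * (x 0 ord_max * (n.*2 == p)%:R).
  move=> pn; rewrite -[LHS](xy (delta_mx 0 (inord p))) bform_oddG mE !mxE /= iE //.
  congr (_ + _); apply: eq_bigr => i _; have := ltn_ord i => ilt.
  by rewrite !mxE /= !iE //; lia.
apply/rowP=> j; rewrite mxE -(inord_val j).
have [jn|jn] := eqVneq (val j) n.*2.
  have := xp n.*2 (leqnn _); rewrite big1 => [|i _]; last first.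
    have := ltn_ord i => ilt.
    have -> : (i.*2.+1 == n.*2) = false by lia.
    have -> : (i.*2 == n.*2) = false by lia.
    by rewrite !mulr0 addr0.
  rewrite eqxx mulr1 add0r jn mE => /esym/eqP.
  by rewrite mulf_eq0 (negPf F2) => /eqP.
have jlt : (j./2 < n)%N by rewrite ltn_half_double ltn_neqAle jn -ltnS ltn_ord.
pose i0 := Ordinal jlt.
(* The partner of coordinate [j] is [j - 1] for odd [j] and [j + 1] for even [j]. *)
have [jodd|jev] := boolP (odd j).
  have := xp j./2.*2; rewrite (bigD1 i0) //= big1 => [|i ii0]; last first.
    have ne : (i : nat) != j./2 by apply: contraNneq ii0 => e; apply/eqP/val_inj.
    have -> : (i.*2.+1 == j./2.*2) = false by lia.
    have -> : (i.*2 == j./2.*2) = false by lia.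
    by rewrite !mulr0 addr0.
  have -> : (n.*2 == j./2.*2) = false by lia.
  have -> : (j./2.*2.+1 == j./2.*2) = false by lia.
  rewrite eqxx !mulr0 mulr1 !addr0 add0r (_ : j./2.*2.+1 = j); last by lia.
  by move=> <- //; lia.
have := xp j./2.*2.+1; rewrite (bigD1 i0) //= big1 => [|i ii0]; last first.
  have ne : (i : nat) != j./2 by apply: contraNneq ii0 => e; apply/eqP/val_inj.
  have -> : (i.*2.+1 == j./2.*2.+1) = false by lia.
  have -> : (i.*2 == j./2.*2.+1) = false by lia.
  by rewrite !mulr0 addr0.
have -> : (n.*2 == j./2.*2.+1) = false by lia.
have -> : (j./2.*2 == j./2.*2.+1) = false by lia.
rewrite eqxx !mulr0 mulr1 !addr0 (_ : j./2.*2 = j); last by lia.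
by move=> <- //; lia.
Qed.

Lemma bform_inj (F : fieldType) (d : nat) (A B : 'M[F]_d) :
  (forall x y, bform A x y = bform B x y) -> A = B.
Proof.
move=> AB; apply/matrixP=> i j; have := AB (delta_mx 0 i) (delta_mx 0 j).
by rewrite /bform !trmx_delta -!rowE -!colE !mxE.
Qed.

(** Polarization: comparing the values at [x + y] recovers the bilinear form, as 2 is invertible. *)
Lemma oddQ_isometryP (F : finFieldType) (n : nat) (g : 'M[F]_(n.*2.+1)) :
    2%:R != 0 :> F ->
  reflect (g *m oddG F n *m g^T = oddG F n) [forall x, oddQ (x *m g) == oddQ x].
Proof.
move=> F2; apply: (iffP forallP) => [gQ|gG x]; last first.
  by apply/eqP/(mulfI F2); rewrite -!bform_oddQ bform_pull gG.
have gq x : bform (oddG F n) (x *m g) (x *m g) = bform (oddG F n) x x.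
  by rewrite !bform_oddQ (eqP (gQ x)).
have Gn := oddG_nondeg n F2.
apply: bform_inj => x y; rewrite -bform_pull; apply: (mulfI F2).
have := gq (x + y); rewrite mulmxDl !bformE !gq.
rewrite (bformC (y *m g)) // (bformC y) // !addrA => /addIr.
by rewrite -!addrA => /addrI; rewrite -!mulr2n !mulr_natl.
Qed.

(** Under [g = 1 - 2 P], the conditions [g^2 = 1], isometry and determinant 1 become idempotent,
    self-adjoint and of even rank. *)
Lemma ninvol_SOodd (F : finFieldType) (n : nat) :
    2%:R != 0 :> F ->
  ninvol (SOodd F n) = (\sum_(k < n.+1) #|sadj_idem (oddG F n) k.*2|)%N.
Proof.
move=> F2; set G := oddG F n.
pose E := [set P : 'M[F]_(n.*2.+1) | [&& P *m P == P, P *m G == G *m P^T & ~~ odd (\rank P)]].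
transitivity #|E|; last first.
  rewrite -sum1_card (partition_big (fun P : 'M[F]_(n.*2.+1) => inord (\rank P)./2 : 'I_n.+1) xpredT) //=.
  apply: eq_bigr => k _; rewrite -sum1_card; apply: eq_bigl => P.
  rewrite !inE -!andbA; do 2 congr (_ && _).
  have := rank_leq_row P; have := ltn_ord k => kn rP.
  by rewrite -val_eqE /= inordK; lia.
pose h (g : {'GL_(n.*2.+1)[F]}) : 'M[F]_(n.*2.+1) := 2%:R^-1 *: (1%:M - GLval g).
have hK g : GLval g = 1%:M - 2%:R *: h g.
  by rewrite /h scalerA mulfV // scale1r opprB addrC subrK.
have hinj : injective h.
  by move=> g g' e; apply/val_inj; rewrite /= !hK e.
rewrite /ninvol -(card_imset _ hinj); apply: eq_card => P.
have sqE (M : 'M[F]_(n.*2.+1)) : (1%:M - 2%:R *: M) *m (1%:M - 2%:R *: M) = 1%:M <-> M *m M = M.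
  have -> : (1%:M - 2%:R *: M) *m (1%:M - 2%:R *: M) = 1%:M + 4%:R *: (M *m M - M).
    rewrite mulmxBl mul1mx mulmxBr mulmx1 -scalemxAl -scalemxAr scalerA -natrM.
    have M4 : 4%:R *: M = 2%:R *: M + 2%:R *: M by rewrite -scalerDl -natrD.
    by rewrite scalerBr M4 opprB opprD !addrA [1%:M - _ + _]addrAC.
  split=> [/(canRL (addKr _))|->]; last by rewrite subrr scaler0 addr0.
  rewrite addNr => /eqP; rewrite scaler_eq0 (_ : 4%:R = 2%:R * 2%:R :> F) -?natrM //.
  by rewrite natrM mulf_eq0 orbb (negPf F2) subr_eq0 => /eqP.
have isoE (M : 'M[F]_(n.*2.+1)) : M *m M = M ->
    ((1%:M - 2%:R *: M) *m G *m (1%:M - 2%:R *: M)^T = G <-> M *m G = G *m M^T).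
  move=> MM; set g := 1%:M - _.
  have gg : g *m g = 1%:M by apply/sqE.
  (* As [g] is its own inverse, the isometry condition becomes linear in [g], hence in [M]. *)
  have -> : g *m G *m g^T = G <-> g *m G = G *m g^T.
    split=> e; last by rewrite e -mulmxA -trmx_mul gg trmx1 mulmx1.
    by rewrite -{2}e -!mulmxA -trmx_mul gg trmx1 mulmx1.
  rewrite /g mulmxBl mul1mx linearB /= trmx1 mulmxBr mulmx1 linearZ /=.
  rewrite -scalemxAl -scalemxAr; split=> [/addrI/oppr_inj/(scalerI F2)|->] //.
have detE (M : 'M[F]_(n.*2.+1)) : M *m M = M ->
    (\det (1%:M - 2%:R *: M) == 1) = ~~ odd (\rank M).
  move=> MM; rewrite det_1sub2_idem // -signr_odd; case: odd; rewrite ?expr0 ?eqxx //.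
  rewrite expr1; apply/eqP => e; move: F2.
  by rewrite mulr2n -{2}e subrr eqxx.
apply/imsetP/idP => [[g]|].
  rewrite 4!inE => /andP[/andP[/oddQ_isometryP-/(_ F2) gG gd] /eqP gg] ->.
  have {}gg : GLval g *m GLval g = 1%:M.
    by have := congr1 (@GLval _ _) gg; rewrite expgS expg1 GL_ME GL_1E.
  rewrite hK in gg gG gd; have /sqE hh := gg.
  by rewrite hh eqxx -detE // gd andbT; apply/eqP/isoE.
rewrite /E inE => /and3P[/eqP PP /eqP PG Pr].
have /sqE gg := PP; have [gu _] := mulmx1_unit gg.
pose g : {'GL_(n.*2.+1)[F]} := FinRing.Unit gu.
exists g; last by rewrite /h /= opprB addrC subrK scalerA mulVf // scale1r.
apply/setIdP; split; last by apply/eqP/val_inj; rewrite expgS expg1.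
apply/setIdP; split; last by rewrite detE.
by rewrite inE; apply/oddQ_isometryP => //; apply/isoE.
Qed.

(** * Identities for q-binomial coefficients *)

Lemma qbinom_pascal (R : fieldType) (w : R) (n k : nat) :
    (forall i, qpoch w i != 0) -> (k < n)%N ->
  qbinom w n.+1 k.+1 = qbinom w n k.+1 + w ^+ (n - k) * qbinom w n k.
Proof.
move=> P0 kn; rewrite /qbinom subSS.
have -> : (n - k = (n - k.+1).+1)%N by lia.
have nE : n = (k.+1 + (n - k.+1))%N by lia.
have := P0 n.+1; have := P0 k.+1; have := P0 (n - k.+1).+1.
move: (n - k.+1)%N nE => m ->.
rewrite !qpochS !mulf_eq0 !negb_or.
move=> /andP[m0 m1] /andP[k0 k1] /andP[n0 n1].
have -> : w ^+ (k.+1 + m).+1 = w ^+ k.+1 * w ^+ m.+1 by rewrite -exprD addnS.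
move: (qpoch w (k.+1 + m)) n0 => A A0; move: (qpoch w k) (qpoch w m) k0 m0 => B C B0 C0.
move: (w ^+ k.+1) (w ^+ m.+1) k1 m1 => y x y1 x1.
by field; rewrite C0 x1 B0 y1.
Qed.

Lemma qbinom0 (R : fieldType) (w : R) (n : nat) :
  (forall i, qpoch w i != 0) -> qbinom w n 0 = 1.
Proof. by move=> P0; rewrite /qbinom subn0 /qpoch big_ord0 mul1r divff // P0. Qed.

Lemma qbinomnn (R : fieldType) (w : R) (n : nat) :
  (forall i, qpoch w i != 0) -> qbinom w n n = 1.
Proof. by move=> P0; rewrite /qbinom subnn /qpoch big_ord0 mulr1 divff // P0. Qed.

Lemma qbinom_sub (R : fieldType) (w : R) (n k : nat) :
  (k <= n)%N -> qbinom w n (n - k) = qbinom w n k.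
Proof. by move=> kn; rewrite /qbinom subKn // [X in _ / X]mulrC. Qed.

(** Induction on [n] by Pascal's rule. That rule covers the inner terms only; the extreme terms,
    whose coefficients are 1, are split off. *)
Lemma qbinom_theorem (R : fieldType) (w z : R) (n : nat) :
    (forall i, qpoch w i != 0) ->
  \sum_(k < n.+1) qbinom w n k * w ^+ 'C(k, 2) * z ^+ k = \prod_(i < n) (1 + z * w ^+ i).
Proof.
move=> P0; elim: n => [|n IH].
  by rewrite big_ord_recl !big_ord0 qbinom0 // !mulr1 addr0.
rewrite [RHS]big_ord_recr /= -IH big_ord_recl big_ord_recr /= mulrDr mulr1.
rewrite [X in _ + (X + _)](eq_bigr (fun k : 'I_n =>
  qbinom w n k.+1 * w ^+ 'C(k.+1, 2) * z ^+ k.+1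
  + qbinom w n k * w ^+ 'C(k, 2) * z ^+ k * (z * w ^+ n))); last first.
  move=> k _; rewrite /bump /= !add1n qbinom_pascal // binS bin1.
  have -> : w ^+ n = w ^+ (n - k) * w ^+ k by rewrite -exprD subnK // ltnW.
  by rewrite exprD exprS; ring.
rewrite big_split /= addrA addrA [in X in _ = X + _]big_ord_recl /= -!addrA; congr (_ + _).
  by rewrite !qbinom0.
congr (_ + _).
rewrite [in RHS]big_ord_recr /= mulrDl big_distrl /=; congr (_ + _).
by rewrite /bump /= !add1n !qbinomnn // binS bin1 exprD exprS; ring.
Qed.

Lemma bin2D (a b : nat) : ('C(a + b, 2) = 'C(a, 2) + 'C(b, 2) + a * b)%N.
Proof.
elim: b => [|b IH]; first by rewrite bin0n muln0 !addn0.
by rewrite addnS !binS !bin1 IH mulnS; lia.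
Qed.

Lemma bin2_double (a : nat) : (2 * 'C(a, 2) + a = a * a)%N.
Proof.
elim: a => [|a IH]; first by rewrite bin0n.
rewrite binS bin1; lia.
Qed.

(* The q-binomial theorem at z = w^-m and exponent 2m+1: the terms k = m+1+t and
   k = m-t are equal, and on the other side 1 + w^-i = w^-i (1 + w^i). *)
Lemma finite_gauss_identity (R : numFieldType) (w : R) (m : nat) :
    w != 0 -> (forall i, qpoch w i != 0) ->
  \sum_(t < m.+1) qbinom w m.*2.+1 (m.+1 + t) * w ^+ 'C(t.+1, 2) =
  \prod_(i < m) (1 + w ^+ i.+1) ^+ 2.
Proof.
(* The whole q-binomial sum, scaled by [w^C(m+1,2)], consists of two halves equal to [S], hence the
   factor 2. *)
move=> w0 P0; apply: (mulfI (_ : 2%:R != 0 :> R)); first by rewrite pnatr_eq0.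
have mE : m.*2.+1 = (m + m.+1)%N by rewrite -addnn addnS.
rewrite mE; set S := \sum_(t < _) _.
have wm : w ^+ m != 0 by rewrite expf_neq0.
have lowerS : \sum_(k < m.+1) qbinom w (m + m.+1) k * w ^+ 'C(k, 2) * (w ^- m) ^+ k
    * w ^+ 'C(m.+1, 2) = S.
  rewrite (reindex_inj rev_ord_inj); apply: eq_bigr => t _ /=.
  have tm : (t <= m)%N by rewrite -ltnS.
  rewrite subSS -[qbinom _ _ (m - t)]qbinom_sub; last by lia.
  have -> : (m + m.+1 - (m - t) = m.+1 + t)%N by lia.
  rewrite -2!mulrA; congr (_ * _); rewrite exprVn -exprM.
  rewrite mulrCA -exprD; apply: (canLR (mulKf _)); first by rewrite expf_neq0 // expf_neq0.
  rewrite -exprD; congr (_ ^+ _).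
  move: (nat_of_ord t) tm => {}t tm; have := bin2_double (m - t); have := bin2D (m - t) t.+1.
  rewrite addnS subnK // => ->.
  have mt : m = ((m - t) + t)%N by rewrite subnK.
  move: (m - t)%N mt => s ->; rewrite mulnDl mulnS; lia.
have upperS : \sum_(t < m.+1) qbinom w (m + m.+1) (m.+1 + t) * w ^+ 'C(m.+1 + t, 2)
    * (w ^- m) ^+ (m.+1 + t) * w ^+ 'C(m.+1, 2) = S.
  apply: eq_bigr => t _.
  rewrite -2!mulrA; congr (_ * _); rewrite exprVn -exprM.
  rewrite mulrCA -exprD; apply: (canLR (mulKf _)); first by rewrite expf_neq0 // expf_neq0.
  rewrite -exprD; congr (_ ^+ _).
  have := bin2_double m; rewrite bin2D !binS !bin1 ?mulnDr ?mulSn ?mulnS; lia.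
have : \sum_(k < m.+1 + m.+1) qbinom w (m + m.+1) k * w ^+ 'C(k, 2) * (w ^- m) ^+ k =
    \prod_(i < m + m.+1) (1 + w ^- m * w ^+ i) by apply: qbinom_theorem.
move/(congr1 (fun x => x * w ^+ 'C(m.+1, 2))); rewrite big_distrl /=.
rewrite big_split_ord /= lowerS upperS.
rewrite [2%:R * S](_ : _ = S + S); last by rewrite mulr_natl mulr2n.
move=> ->.
(* The middle factor [i = m] is [1 + 1], which accounts for the 2 on the product side. *)
rewrite big_split_ord big_ord_recl /= addn0 mulVf //.
have -> : \prod_(i < m) (1 + w ^- m * w ^+ (m + bump 0 i)) = \prod_(i < m) (1 + w ^+ i.+1).
  by apply: eq_bigr => i _; rewrite exprD mulKf.
(* Since [C(m+1,2) = 1 + ... + m], this power clears all the negative exponents. *)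
have E : \prod_(i < m) (1 + w ^- m * w ^+ i) * w ^+ 'C(m.+1, 2) = \prod_(i < m) (1 + w ^+ i.+1).
  have -> : 'C(m.+1, 2) = (\sum_(i < m) i.+1)%N.
    by rewrite -triangular_sum big_nat_recl // add0n big_mkord.
  rewrite (reindex_inj rev_ord_inj) expr_sum -big_split /=; apply: eq_bigr => i _.
  have -> : w ^+ m = w ^+ (m - i.+1) * w ^+ i.+1 by rewrite -exprD subnK.
  have := expf_neq0 (m - i.+1) w0; have := expf_neq0 i.+1 w0.
  by move: (w ^+ _) (w ^+ _) => x y x0 y0; field; rewrite x0 y0.
rewrite mulrAC E prodrXl; ring.
Qed.

(** * Limits *)

Lemma leq_bin2S (t : nat) : (t <= 'C(t.+1, 2))%N.
Proof. by rewrite binS bin1 leq_addl. Qed.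

(* The term w^n makes the lower bound 1/2 provable by induction. *)
Lemma qpoch_lower (R : realType) (w : R) (n : nat) : 0 <= w -> w * 3%:R <= 1 -> (1 + w ^+ n) / 2%:R <= qpoch w n.
Proof.
move=> w0 w1; elim: n => [|n IH].
  by rewrite /qpoch big_ord0 expr0 divff.
have wn0 : 0 <= w ^+ n by rewrite exprn_ge0.
have w11 : w <= 1 by nra.
have wn1 : w ^+ n <= 1 by rewrite exprn_ile1.
rewrite qpochS exprS; apply: le_trans (ler_wpM2r _ IH); last by nra.
by move: (w ^+ n) wn0 wn1 => x x0 x1; nra.
Qed.

Local Open Scope classical_set_scope.

Lemma qpoch_nonincreasing (R : realType) (w : R) :
  0 <= w -> w * 3%:R <= 1 -> nonincreasing_seq (qpoch w).
Proof.
move=> w0 w3; have w1 : w <= 1 by lra.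
apply/nonincreasing_seqP => n; rewrite qpochS.
have p0 : 0 <= qpoch w n.
  by apply: le_trans (qpoch_lower n w0 w3); rewrite divr_ge0 // addr_ge0 // exprn_ge0.
have := exprn_ge0 n.+1 w0; have := exprn_ile1 n.+1 w0 w1.
by move: (w ^+ _) (qpoch w n) p0 => x p p0 x1 x0; nra.
Qed.

Lemma qpoch_ge_half (R : realType) (w : R) (n : nat) :
  0 <= w -> w * 3%:R <= 1 -> 2%:R^-1 <= qpoch w n.
Proof.
move=> w0 w3; apply: le_trans (qpoch_lower n w0 w3).
by rewrite ler_pdivlMr // mulVf // lerDl exprn_ge0.
Qed.

Lemma cvg_qpoch (R : realType) (w : R) :
    0 <= w -> w * 3%:R <= 1 ->
  exists2 P : R, P != 0 & qpoch w @ \oo --> P.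
Proof.
move=> w0 w3; have cv : cvgn (qpoch w).
  apply: nonincreasing_is_cvgn; first exact: qpoch_nonincreasing.
  by exists 2%:R^-1 => _ [n _ <-]; exact: qpoch_ge_half.
exists (limn (qpoch w)) => //; rewrite gt_eqF // (@lt_le_trans _ _ 2%:R^-1) //.
by apply: limr_ge => //; apply: nearW => n; exact: qpoch_ge_half.
Qed.

(** [qpoch w n] is at most [qpoch w (n - k)], and [qpoch w k] is at least 1/2. The bound is uniform
    in [n] and [k], as domination requires. *)
Lemma qbinom_bounds (R : realType) (w : R) (n k : nat) :
    0 <= w -> w * 3%:R <= 1 -> (k <= n)%N ->
  0 <= qbinom w n k <= 2%:R.
Proof.
move=> w0 w3 kn; have h i := qpoch_ge_half i w0 w3.
have p0 i : 0 < qpoch w i by apply: lt_le_trans (h i); rewrite invr_gt0.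
rewrite /qbinom; apply/andP; split.
  by rewrite divr_ge0 ?mulr_ge0 // ltW.
rewrite ler_pdivrMr ?mulr_gt0 //.
have := qpoch_nonincreasing w0 w3 (leq_subr k n).
have := h k; have := p0 (n - k)%N.
by move: (qpoch w n) (qpoch w k) (qpoch w _) => x y z z0 y2 xz; nra.
Qed.

(** The two linear bounds force [k n] and [N n - k n], hence [N n], to infinity, so the quotient
    tends to [P / (P P)]. *)
Lemma cvg_qbinom (R : realType) (w P : R) (N k : nat -> nat) (t : nat) :
    0 <= w -> w * 3%:R <= 1 -> P != 0 -> qpoch w @ \oo --> P ->
    (forall n, n <= (k n).*2 + t)%N -> (forall n, n <= (N n - k n).*2 + t)%N ->
  qbinom w (N n) (k n) @[n --> \oo] --> P^-1.
Proof.
move=> w0 w3 P0 cP hk hNk.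
have sub (u : nat -> nat) : (forall n, n <= (u n).*2 + t)%N -> qpoch w (u n) @[n --> \oo] --> P.
  move=> hu; apply: cvg_comp cP; apply/cvgnyPge => A.
  by near=> n; have := hu n; have : (A.*2 + t <= n)%N by [near: n; exact: nbhs_infty_ge]; lia.
have -> : P^-1 = P / (P * P) by rewrite invfM mulrA divff // mul1r.
apply: cvgM; first by apply: sub => n; have := hk n; have := hNk n; lia.
apply: cvgV; first by rewrite mulf_neq0.
by apply: cvgM; apply: sub.
Unshelve. all: by end_near. Qed.

(** Dominated convergence for sums of growing length. The first [M] differences tend to 0 one by
    one, and the others are bounded by a geometric tail. *)
Lemma tannery (R : realType) (f : nat -> nat -> R) (g : nat -> R) (C w : R) :
    0 < w < 1 ->
    (forall n t, (t <= n)%N -> `|f n t| <= C * w ^+ t) ->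
    (forall t, f n t @[n --> \oo] --> g t) ->
  \sum_(t < n.+1) f n t @[n --> \oo] --> limn (series g).
Proof.
move=> /andP[w0 w1] fb fg.
have w1n : `|w| < 1 by rewrite ger0_norm // ltW.
have C0 : 0 <= C by have := fb 0%N 0%N (leqnn _); rewrite expr0 mulr1; apply: le_trans.
have gb t : `|g t| <= C * w ^+ t.
  have cn : `|f n t| @[n --> \oo] --> `|g t| by exact: cvg_norm.
  rewrite -(cvg_lim _ cn) //; apply: limr_le; first by apply/cvg_ex; exists `|g t|.
  by near=> n; apply: fb; near: n; exact: nbhs_infty_ge.
have cg : cvgn (series g).
  apply: normed_cvg; apply: (@series_le_cvg _ _ (geometric C w)) => [n|n|n|] /=.
  - by rewrite normr_ge0.
  - by apply: mulr_ge0 => //; exact: exprn_ge0 (ltW w0).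
  - exact: gb.
  - exact: is_cvg_geometric_series.
have cg1 : series g n.+1 @[n --> \oo] --> limn (series g).
  by rewrite (@cvg_shiftS _ (series g)).
have sumE n : \sum_(t < n.+1) f n t = \sum_(t < n.+1) (f n t - g t) + series g n.+1.
  rewrite /series /= big_mkord -big_split /=.
  by apply: eq_bigr => t _; rewrite subrK.
under eq_cvg => n do rewrite sumE.
rewrite -[limn _]add0r; apply: cvgD cg1.
apply/cvgrPdist_lt => e e0.
have cgeo : geometric (2%:R * C / (1 - w)) w @ \oo --> 0 by exact: cvg_geometric.
have e2 : 0 < e / 2%:R by rewrite divr_gt0.
(* [M] is chosen so that the tail bound [2 C w^M / (1 - w)] is below [e / 2]. *)
have [M _ hM] : \forall M \near \oo, `|0 - geometric (2%:R * C / (1 - w)) w M| < e / 2%:R.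
  by move/cvgrPdist_lt: cgeo; apply.
have {hM} := hM M (leqnn M); rewrite sub0r normrN /= => hM.
have chead K : \sum_(t < K) `|f n t - g t| @[n --> \oo] --> 0.
  elim: K => [|K IH].
    by under eq_cvg do rewrite big_ord0; exact: cvg_cst.
  have hK : `|f n K - g K| @[n --> \oo] --> (0 : R).
    rewrite -(normr0 R) -(subrr (g K)).
    by apply: cvg_norm; apply: cvgB => //; exact: cvg_cst.
  have : \sum_(t < K) `|f n t - g t| + `|f n K - g K| @[n --> \oo] --> 0 + (0 : R).
    exact: cvgD.
  by rewrite addr0; under [X in _ -> X]eq_cvg do rewrite big_ord_recr.
near=> n.
have Mn : (M <= n.+1)%N by near: n; exists M => // k /= /leqW.
rewrite sub0r normrN (le_lt_trans (ler_norm_sum _ _ _)) //.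
rewrite -(big_mkord xpredT (fun t => `|f n t - g t|)) (big_cat_nat (leq0n M) Mn) /=.
rewrite [e]splitr; apply: ltrD.
  rewrite big_mkord -[X in X < _]ger0_norm ?sumr_ge0 // -normrN -sub0r.
  by near: n; move/cvgrPdist_lt: (chead M); apply.
apply: le_lt_trans hM; apply: le_trans (ler_norm _).
apply: (@le_trans _ _ (\sum_(M <= t < n.+1) 2%:R * C * w ^+ t)).
  rewrite big_nat [leRHS]big_nat; apply: ler_sum => t /andP[Mt tn].
  apply: le_trans (ler_normB _ _) _.
  by have := fb n t tn; have := gb t; lra.
rewrite -big_distrr /= -[leRHS]mulrA; apply: ler_wpM2l; first by rewrite mulr_ge0.
have -> : n.+1 = (M + (n.+1 - M))%N by rewrite subnKC.
rewrite geometric_partial_tail [leRHS]mulrC.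
by apply: geometric_le_lim => //; exact: exprn_ge0 (ltW w0).
Unshelve. all: by end_near. Qed.

(** * Triangular exponents and the common limit *)

(* tri_index n k is the t >= 0 with t(t+1) = (2k-n)(2k-n-1), and tri_rank n is
   the inverse of tri_index n. *)
Definition tri_index (n k : nat) : nat :=
  if (n < k.*2)%N then (k.*2 - n.+1)%N else (n - k.*2)%N.

Definition tri_rank (n t : nat) : nat :=
  if odd (n - t) then ((n + t).+1)./2 else (n - t)./2.

(** The parity of [n - t] tells which of the two cases of [tri_index] produced [t]. *)
Lemma tri_indexK (n k : nat) : (k <= n)%N -> tri_rank n (tri_index n k) = k.
Proof.
rewrite /tri_index /tri_rank => kn; case: ltnP => h.
  have -> : (n - (k.*2 - n.+1) = (n - k).*2.+1)%N by lia.
  have -> : ((n + (k.*2 - n.+1)).+1 = k.*2)%N by lia.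
  by rewrite doubleK /= odd_double.
by rewrite subKn // odd_double doubleK.
Qed.

(** Half of [(2k-n)(2k-n-1)] is [n(n+1)/2 - 2k(n-k) - k]. So division by [Q^C(n+1,2)] turns the
    power of [Q] in the subspace count into [w^C(t+1,2)]. *)
Lemma tri_index_exponent (n k : nat) : (k <= n)%N ->
  (2 * (k * (n - k)) + k + 'C((tri_index n k).+1, 2) = 'C(n.+1, 2))%N.
Proof.
move=> kn; rewrite /tri_index; case: ltnP => h.
  have [m [s [-> ->]]] : exists m s, k = (m + s.+1)%N /\ n = (m + (m + s.+1))%N.
    by exists (n - k)%N, (k - (n - k)).-1; lia.
  rewrite addnK (_ : ((m + s.+1).*2 - _).+1 = s.+1)%N; last by lia.
  rewrite (_ : (m + (m + s.+1)).+1 = (m + m).+1 + s.+1)%N; last by rewrite addSn addnA.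
  rewrite bin2D; have -> : 'C((m + m).+1, 2) = (m * m * 2 + m)%N.
    by rewrite binS bin1 bin2D; have := bin2_double m; lia.
  by ring.
have [s sE] : exists s, n = (k + (k + s))%N by exists (n - k.*2)%N; lia.
subst n; rewrite addKn (_ : (k + (k + s) - k.*2)%N = s); last by lia.
rewrite (_ : (k + (k + s)).+1 = k + k + s.+1)%N; last by rewrite addnS addnA.
have kk : ('C(k + k, 2) + k = k * k * 2)%N.
  by rewrite bin2D; have := bin2_double k; lia.
rewrite (bin2D (k + k)); apply: (@addIn k).
rewrite [RHS](_ : _ = 'C(k + k, 2) + k + ('C(s.+1, 2) + (k + k) * s.+1))%N; last by ring.
by rewrite kk; ring.
Qed.

Theorem theorem7p2 (R : realType) (q : nat) (q_odd : odd q)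
    (F : finFieldType) (cardF : #|F| = q) :
  exists L : R,
    (fun m : nat => \prod_(1 <= i < m.+1) (1 + 1 / (q%:R : R) ^+ (2 * i)) ^+ 2)
      @ \oo --> L /\
    (fun n : nat => (ninvol (SOodd F n))%:R / (q%:R : R) ^+ (n ^ 2 + n))
      @ \oo --> L.
Proof.
have qodd : odd #|F| by rewrite cardF.
have q3 : (3 <= q)%N.
  by have := card_finNzRing_gt1 F; rewrite cardF => q1; case: q q_odd q1 {cardF} => [|[|[|]]].
have F2 := finField_2neq0 qodd.
set w : R := q%:R ^- 2.
have q0 : 0 < q%:R :> R by rewrite ltr0n; lia.
have w0 : 0 < w by rewrite invr_gt0 exprn_gt0.
have w3 : w * 3%:R <= 1.
  rewrite mulrC ler_pdivrMr ?exprn_gt0 // mul1r -natrX ler_nat.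
  by rewrite (leq_trans q3) // -mulnn leq_pmulr // (leq_trans _ q3).
have w1 : w < 1 by lra.
have w01 : 0 < w < 1 by rewrite w0 w1.
have P0 i : qpoch w i != 0.
  by rewrite gt_eqF // (lt_le_trans _ (qpoch_ge_half i (ltW w0) w3)) // invr_gt0.
have [P Pn0 cP] := cvg_qpoch (ltW w0) w3.
have wC t : w ^+ 'C(t.+1, 2) <= w ^+ t.
  by rewrite ler_wiXn2l ?ltW // leq_bin2S.
have bnd n k t : (k <= n)%N -> `|qbinom w n k * w ^+ 'C(t.+1, 2)| <= 2%:R * w ^+ t.
  move=> kn; have /andP[b0 b2] := qbinom_bounds (ltW w0) w3 kn.
  have x0 : 0 <= w ^+ 'C(t.+1, 2) by rewrite exprn_ge0 // ltW.
  rewrite ger0_norm; last exact: mulr_ge0.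
  by apply: ler_pM.
(* The common limit: in both sums the q-binomial with [t] fixed tends to [P^-1]. *)
exists (limn (series (fun t => P^-1 * w ^+ 'C(t.+1, 2)))); split.
  have := @tannery R (fun m t => qbinom w m.*2.+1 (m.+1 + t) * w ^+ 'C(t.+1, 2))
    (fun t => P^-1 * w ^+ 'C(t.+1, 2)) 2%:R w w01.
  rewrite (_ : (fun m : nat => \prod_(1 <= i < m.+1) _)
      = (fun m => \sum_(t < m.+1) qbinom w m.*2.+1 (m.+1 + t) * w ^+ 'C(t.+1, 2))).
    apply; first by move=> m t tm; apply: bnd; lia.
    move=> t; apply: cvgM; last exact: cvg_cst.
    by apply: (cvg_qbinom (t := t) (ltW w0) w3 Pn0 cP) => n; lia.
  apply/funext => m; rewrite finite_gauss_identity ?gt_eqF // big_add1 big_mkord.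
  by apply: eq_bigr => i _; rewrite /w exprVn -exprM div1r.
have := @tannery R (fun n t => qbinom w n (tri_rank n t) * w ^+ 'C(t.+1, 2))
    (fun t => P^-1 * w ^+ 'C(t.+1, 2)) 2%:R w w01.
rewrite (_ : (fun n : nat => _ / _)
    = (fun n => \sum_(t < n.+1) qbinom w n (tri_rank n t) * w ^+ 'C(t.+1, 2))).
  apply; first by move=> n t tn; apply: bnd; rewrite /tri_rank; case: ifP; lia.
  move=> t; apply: cvgM; last exact: cvg_cst.
  (* For odd [n - t], the complementary index [n - k] is [(n - t - 1)/2], hence the slack [t.+1]
     instead of [t]. *)
  apply: (cvg_qbinom (t := t.+1) (ltW w0) w3 Pn0 cP) => n;
    by rewrite /tri_rank; case: ifP; lia.
apply/funext => n.
(* The sum over [k] is reindexed by [t]; an injective self-map of a finite type is a bijection. *)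
pose h (k : 'I_n.+1) : 'I_n.+1 := inord (tri_index n k).
have hE k : h k = tri_index n k :> nat.
  by rewrite inordK // /tri_index; have := ltn_ord k; case: ifP; lia.
have hinj : injective h.
  move=> k l /(congr1 val); rewrite /= !hE => e; apply: val_inj => /=.
  by rewrite -(tri_indexK (leq_ord k)) e tri_indexK // leq_ord.
rewrite ninvol_SOodd // natr_sum big_distrl /= [RHS](reindex_inj hinj) /=.
apply: eq_bigr => k _; have kn : (k <= n)%N by rewrite -ltnS.
rewrite (card_sadj_idem_even_rank _ qodd (oddG_nondeg n F2) kn) cardF -/w hE tri_indexK //.
rewrite mulrAC mulrC; congr (_ * _).
have -> : (n ^ 2 + n = 2 * 'C(n.+1, 2))%N.
  by rewrite binS bin1 mulnDr -mulnn; have := bin2_double n; lia.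
rewrite exprM -(tri_index_exponent kn) [X in _ / X]exprD invfM mulrA mulfV ?mul1r; last first.
  by rewrite !expf_neq0 // gt_eqF.
by rewrite /w exprVn.
Qed.
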